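(* Let $n$ be a positive integer. If $\mathbf{L}$ is a finitely generated proper $n$-periodic $\ell$-pregroup whose group skeleton $\mathbf{L}_g$ is a totally ordered abelian $\ell$-group, then $\mathbf{L}\cong\mathbf{H}\overrightarrow{\times}\mathbf{F}_k(\mathbb{Z})$ for some totally ordered abelian $\ell$-group $\mathbf{H}$ and some $k\mid n$.
   Context: An $\ell$-pregroup is an algebra $(A,\wedge,\vee,\cdot,1,{}^{\ell},{}^{r})$ such that $(A,\wedge,\vee)$ is a lattice, $(A,\cdot,1)$ is a monoid, multiplication is order-preserving in both arguments, and $a^{\ell}a\le 1\le aa^{\ell}$ and $aa^{r}\le 1\le a^{r}a$ for all $a\in A$. Write $x^{\ell^k}$, $x^{r^k}$ for the $k$-fold application of ${}^\ell$, ${}^r$. An $\ell$-pregroup is $n$-periodic if it satisfies $x^{\ell^n}\approx x^{r^n}$. The $\ell$-pregroups satisfying $x^\ell\approx x^r$ are exactly the $\ell$-groups (with $x^\ell=x^r=x^{-1}$); an $\ell$-pregroup is proper if it is not an $\ell$-group. The group skeleton of $\mathbf{L}$ is the subalgebra $\mathbf{L}_g$ with universe $\{a\in L: a^\ell=a^r\}$; it is an $\ell$-group consisting of the invertible elements of $\mathbf{L}$. For a totally ordered $\ell$-group $\mathbf{H}$ (possibly trivial) and an $\ell$-pregroup $\mathbf{M}$, the lexicographic product $\mathbf{H}\overrightarrow{\times}\mathbf{M}$ is the $\ell$-pregroup on $H\times M$ with coordinatewise $\cdot$, ${}^\ell$, ${}^r$, unit $(1,1)$, and order $(h_1,a_1)\le(h_2,a_2)$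 iff $h_1<h_2$ or ($h_1=h_2$ and $a_1\le a_2$). $\mathbf{F}(\mathbb{Z})$ is the $\ell$-pregroup of all order-preserving maps $f\colon\mathbb{Z}\to\mathbb{Z}$ such that $f^{-1}[\{x\}]$ is finite for every $x\in\mathbb{Z}$, with composition as multiplication, the identity map as $1$, the pointwise order, and $f^{\ell}(q)=\min\{p: q\le f(p)\}$, $f^{r}(q)=\max\{p: f(p)\le q\}$. $\mathbf{F}_k(\mathbb{Z})$ is the subalgebra of all $f$ with $f^{\ell^k}=f^{r^k}$; equivalently, all $f\in \mathbf{F}(\mathbb{Z})$ with $f(x+k)=f(x)+k$ for all $x\in\mathbb{Z}$. *)

(* Defs.v *)
From HB Require Import structures.
From mathcomp Require Import all_boot all_order all_algebra.
From mathcomp Require Import zify.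
From mathcomp Require Import boolp classical_sets functions cardinality.

Set Implicit Arguments.
Unset Strict Implicit.
Unset Printing Implicit Defensive.

Import Order.TTheory GRing.Theory Num.Theory.

Local Open Scope classical_set_scope.
Local Open Scope group_scope.
Local Open Scope order_scope.

(* [ladj a] is a^l and [radj a] is a^r.  The display [d] only selects the   *)
(* printing of the order; isomorphisms below ignore it.                     *)
HB.mixin Record isLPregroup d T of Order.Lattice d T & Monoid T := {
  ladj : T -> T;
  radj : T -> T;
  lemul2r : forall z x y : T, x <= y -> x * z <= y * z;
  lemul2l : forall z x y : T, x <= y -> z * x <= z * y;
  ladj_mul_le1 : forall a : T, ladj a * a <= (1 : T);
  mul_ladj_ge1 : forall a : T, (1 : T) <= a * ladj a;
  mul_radj_le1 : forall a : T, a * radj a <= (1 : T);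
  radj_mul_ge1 : forall a : T, (1 : T) <= radj a * a
}.

#[short(type="lpregroupType")]
HB.structure Definition LPregroup d :=
  { T of Order.Lattice d T & Monoid T & isLPregroup d T }.

Arguments lemul2r {d s} z [x y].
Arguments lemul2l {d s} z [x y].

HB.mixin Record LPregroup_isLGroup d T of LPregroup d T := {
  ladj_radj : forall a : T, ladj a = radj a
}.

#[short(type="lgroupType")]
HB.structure Definition LGroup d :=
  { T of LPregroup d T & LPregroup_isLGroup d T }.

#[short(type="totalLGroupType")]
HB.structure Definition TotalLGroup d :=
  { T of Order.Total d T & LGroup d T }.

Definition periodic_lpregroup d (L : lpregroupType d) (n : nat) : Prop :=
  forall x : L, iter n ladj x = iter n radj x.

Definition proper_lpregroup d (L : lpregroupType d) : Prop :=
  ~ (forall x : L, ladj x = radj x).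

Record subalgebra d (L : lpregroupType d) (S : set L) : Prop := Subalgebra {
  subalgebra1 : S 1;
  subalgebraM : forall x y, S x -> S y -> S (x * y);
  subalgebraI : forall x y, S x -> S y -> S (x `&` y);
  subalgebraU : forall x y, S x -> S y -> S (x `|` y);
  subalgebra_ladj : forall x, S x -> S (ladj x);
  subalgebra_radj : forall x, S x -> S (radj x)
}.

Definition finitely_generated d (L : lpregroupType d) : Prop :=
  exists2 A : set L, finite_set A & smallest (@subalgebra d L) A = [set: L].

Record lp_isomorphism d d' (L : lpregroupType d) (M : lpregroupType d')
    (f : L -> M) : Prop := LPIsomorphism {
  lp_iso_bij : bijective f;
  lp_iso1 : f 1 = 1;
  lp_isoM : {morph f : x y / x * y};
  lp_isoI : {morph f : x y / x `&` y};
  lp_isoU : {morph f : x y / x `|` y};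
  lp_iso_ladj : {morph f : x / ladj x};
  lp_iso_radj : {morph f : x / radj x}
}.

Definition lp_isomorphic d d' (L : lpregroupType d) (M : lpregroupType d') :
  Prop := exists f : L -> M, lp_isomorphism f.

Section LPregroupTheory.
Context d (L : lpregroupType d).
Implicit Types x y z : L.

Lemma lemul2 x y z t : x <= y -> z <= t -> x * z <= y * t.
Proof. by move=> xy zt; apply: le_trans (lemul2r _ xy) (lemul2l _ zt). Qed.

Lemma ladj_unique x y : y * x <= (1 : L) -> (1 : L) <= x * y -> y = ladj x.
Proof.
move=> yx xy; apply: le_anti; apply/andP; split.
  rewrite -[y]mulg1; apply: le_trans (lemul2l y (mul_ladj_ge1 x)) _.
  by rewrite mulgA -[leRHS]mul1g; apply: lemul2r.
rewrite -[ladj x]mulg1; apply: le_trans (lemul2l _ xy) _.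
by rewrite mulgA -[leRHS]mul1g; apply/lemul2r/ladj_mul_le1.
Qed.

Lemma radj_unique x y : x * y <= (1 : L) -> (1 : L) <= y * x -> y = radj x.
Proof.
move=> xy yx; apply: le_anti; apply/andP; split.
  rewrite -[y]mul1g; apply: le_trans (lemul2r y (radj_mul_ge1 x)) _.
  by rewrite -mulgA -[leRHS]mulg1; apply: lemul2l.
rewrite -[radj x]mul1g; apply: le_trans (lemul2r _ yx) _.
by rewrite -mulgA -[leRHS]mulg1; apply/lemul2l/mul_radj_le1.
Qed.

Lemma ladjK : cancel (@ladj d L) radj.
Proof.
by move=> x; apply/esym/radj_unique; [exact: ladj_mul_le1|exact: mul_ladj_ge1].
Qed.

Lemma radjK : cancel (@radj d L) ladj.
Proof.
by move=> x; apply/esym/ladj_unique; [exact: mul_radj_le1|exact: radj_mul_ge1].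
Qed.

Lemma ladj1 : ladj (1 : L) = 1.
Proof. by apply/esym/ladj_unique; rewrite mulg1. Qed.

Lemma radj1 : radj (1 : L) = 1.
Proof. by apply/esym/radj_unique; rewrite mulg1. Qed.

Lemma ladjM x y : ladj (x * y) = ladj y * ladj x.
Proof.
apply/esym/ladj_unique.
  rewrite -mulgA [ladj x * _]mulgA; apply: le_trans (ladj_mul_le1 y).
  apply: lemul2l; rewrite -[leRHS]mul1g; exact/lemul2r/ladj_mul_le1.
rewrite -mulgA [y * _]mulgA; apply: le_trans (mul_ladj_ge1 x) _.
apply: lemul2l; rewrite -[leLHS]mul1g; exact/lemul2r/mul_ladj_ge1.
Qed.

Lemma radjM x y : radj (x * y) = radj y * radj x.
Proof. by apply: (can_inj ladjK); rewrite ladjM !radjK. Qed.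

Lemma le_ladj x y : x <= y -> ladj y <= ladj x.
Proof.
move=> xy; rewrite -[ladj y]mulg1; apply: le_trans (lemul2l _ (mul_ladj_ge1 x)) _.
rewrite mulgA -[leRHS]mul1g; apply: lemul2r.
exact: le_trans (lemul2l _ xy) (ladj_mul_le1 y).
Qed.

Lemma le_radj x y : x <= y -> radj y <= radj x.
Proof.
move=> xy; rewrite -[radj y]mul1g; apply: le_trans (lemul2r _ (radj_mul_ge1 x)) _.
rewrite -mulgA -[leRHS]mulg1; apply: lemul2l.
exact: le_trans (lemul2r _ xy) (mul_radj_le1 y).
Qed.

Lemma ladjI x y : ladj (x `&` y) = ladj x `|` ladj y.
Proof.
apply: le_anti; rewrite leUx !le_ladj ?leIl ?leIr // !andbT.
rewrite -[leRHS]radjK; apply: le_ladj; rewrite lexI.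
by rewrite -[X in _ <= X](ladjK x) -[X in _ && (_ <= X)](ladjK y) !le_radj
  ?leUl ?leUr.
Qed.

Lemma ladjU x y : ladj (x `|` y) = ladj x `&` ladj y.
Proof.
apply: le_anti; rewrite lexI !le_ladj ?leUl ?leUr //=.
rewrite -[leLHS]radjK; apply: le_ladj; rewrite leUx.
by rewrite -[X in X <= _](ladjK x) -[X in _ && (X <= _)](ladjK y) !le_radj
  ?leIl ?leIr.
Qed.

Lemma radjI x y : radj (x `&` y) = radj x `|` radj y.
Proof. by apply: (can_inj ladjK); rewrite ladjU !radjK. Qed.

Lemma radjU x y : radj (x `|` y) = radj x `&` radj y.
Proof. by apply: (can_inj ladjK); rewrite ladjI !radjK. Qed.

Lemma iter_adjE k (f : L -> L) : (f = ladj \/ f = radj) ->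
  [/\ iter k f 1 = 1,
      forall x y, iter k f (x * y) =
        if odd k then iter k f y * iter k f x else iter k f x * iter k f y,
      forall x y, iter k f (x `&` y) =
        if odd k then iter k f x `|` iter k f y else iter k f x `&` iter k f y
    & forall x y, iter k f (x `|` y) =
        if odd k then iter k f x `&` iter k f y else iter k f x `|` iter k f y].
Proof.
move=> fE.
have [f1 fM fI fU] : [/\ f 1 = 1, forall x y, f (x * y) = f y * f x,
    forall x y, f (x `&` y) = f x `|` f y
  & forall x y, f (x `|` y) = f x `&` f y].
  case: fE => ->; split; [exact: ladj1 | exact: ladjM | exact: ladjI
    | exact: ladjU | exact: radj1 | exact: radjM | exact: radjI | exact: radjU].
elim: k => [|k [IH1 IHM IHI IHU]] //; split => [|x y|x y|x y] /=.
- by rewrite IH1.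
- by rewrite IHM; case: odd; rewrite /= fM.
- by rewrite IHI; case: odd; rewrite /= ?fI ?fU.
- by rewrite IHU; case: odd; rewrite /= ?fI ?fU.
Qed.

Lemma iter_radj_ladj k x : iter k radj (ladj x) = ladj (iter k radj x).
Proof. by elim: k => //= k ->; rewrite ladjK radjK. Qed.

Lemma iter_ladj_radj k x : iter k ladj (radj x) = radj (iter k ladj x).
Proof. by elim: k => //= k ->; rewrite ladjK radjK. Qed.

End LPregroupTheory.

(* The subalgebra {x : x^(l^k) = x^(r^k)} of an l-pregroup; it is the group *)
(* skeleton for k = 1 and yields F_k(Z) from F(Z).                          *)
Definition periodic_mem d (L : lpregroupType d) (k : nat) : {pred L} :=
  fun x => iter k ladj x == iter k radj x.
Arguments periodic_mem {d} L k _.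

Section Periodic.
Context d (L : lpregroupType d) (k : nat).

Record periodic_sub : predArgType :=
  PeriodicSub { periodic_val : L; _ : periodic_val \in periodic_mem L k }.

HB.instance Definition _ := [isSub for periodic_val].
HB.instance Definition _ := [Choice of periodic_sub by <:].

Fact periodic_umagma_closed : umagma_closed (periodic_mem L k).
Proof.
have [l1 lM _ _] := iter_adjE k (or_introl erefl : (@ladj d L) = ladj \/ _).
have [r1 rM _ _] := iter_adjE k (or_intror erefl : _ \/ (@radj d L) = radj).
split=> [|x y]; rewrite !unfold_in ?l1 ?r1 // => /eqP xE /eqP yE.
by rewrite lM rM xE yE.
Qed.

Fact periodic_meet_closed : meet_closed (periodic_mem L k).
Proof.
have [_ _ lI _] := iter_adjE k (or_introl erefl : (@ladj d L) = ladj \/ _).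
have [_ _ rI _] := iter_adjE k (or_intror erefl : _ \/ (@radj d L) = radj).
by move=> x y; rewrite !unfold_in => /eqP xE /eqP yE; rewrite lI rI xE yE.
Qed.

Fact periodic_join_closed : join_closed (periodic_mem L k).
Proof.
have [_ _ _ lU] := iter_adjE k (or_introl erefl : (@ladj d L) = ladj \/ _).
have [_ _ _ rU] := iter_adjE k (or_intror erefl : _ \/ (@radj d L) = radj).
by move=> x y; rewrite !unfold_in => /eqP xE /eqP yE; rewrite lU rU xE yE.
Qed.

HB.instance Definition _ := Order.SubChoice_isSubLattice.Build d L
  (periodic_mem L k) d periodic_sub periodic_meet_closed periodic_join_closed.
HB.instance Definition _ := SubChoice_isSubMonoid.Build L
  (periodic_mem L k) periodic_sub periodic_umagma_closed.

Fact periodic_ladj_subproof (x : periodic_sub) :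
  ladj (val x) \in periodic_mem L k.
Proof.
have /eqP xE := valP x.
by rewrite unfold_in iter_radj_ladj -iterSr iterS xE.
Qed.

Fact periodic_radj_subproof (x : periodic_sub) :
  radj (val x) \in periodic_mem L k.
Proof.
have /eqP xE := valP x.
by rewrite unfold_in iter_ladj_radj -iterSr iterS xE.
Qed.

Definition periodic_ladj x : periodic_sub := PeriodicSub (periodic_ladj_subproof x).
Definition periodic_radj x : periodic_sub := PeriodicSub (periodic_radj_subproof x).

Let leE (x y : periodic_sub) : (x <= y) = (val x <= val y).
Proof. by rewrite -Order.le_val. Qed.

Fact periodic_lemul2r (z x y : periodic_sub) : x <= y -> x * z <= y * z.
Proof. by rewrite !leE !valM; exact: lemul2r. Qed.

Fact periodic_lemul2l (z x y : periodic_sub) : x <= y -> z * x <= z * y.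
Proof. by rewrite !leE !valM; exact: lemul2l. Qed.

Fact periodic_ladj_mul_le1 x : periodic_ladj x * x <= (1 : periodic_sub).
Proof. by rewrite leE valM val1; exact: ladj_mul_le1. Qed.

Fact periodic_mul_ladj_ge1 x : (1 : periodic_sub) <= x * periodic_ladj x.
Proof. by rewrite leE valM val1; exact: mul_ladj_ge1. Qed.

Fact periodic_mul_radj_le1 x : x * periodic_radj x <= (1 : periodic_sub).
Proof. by rewrite leE valM val1; exact: mul_radj_le1. Qed.

Fact periodic_radj_mul_ge1 x : (1 : periodic_sub) <= periodic_radj x * x.
Proof. by rewrite leE valM val1; exact: radj_mul_ge1. Qed.

HB.instance Definition _ := isLPregroup.Build d periodic_sub
  periodic_lemul2r periodic_lemul2l periodic_ladj_mul_le1
  periodic_mul_ladj_ge1 periodic_mul_radj_le1 periodic_radj_mul_ge1.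

End Periodic.

Definition group_skeleton d (L : lpregroupType d) := periodic_sub L 1.

HB.instance Definition _ d (L : lpregroupType d) :=
  LPregroup.copy (group_skeleton L) (periodic_sub L 1).

Fact group_skeleton_ladj_radj d (L : lpregroupType d) (x : group_skeleton L) :
  ladj x = radj x.
Proof. by apply: val_inj; apply/eqP; exact: (valP x). Qed.

HB.instance Definition _ d (L : lpregroupType d) :=
  LPregroup_isLGroup.Build d (group_skeleton L) (@group_skeleton_ladj_radj d L).

(* The alias keeps the lexicographic order off the product type itself.     *)
Definition lexprod d d' (H : totalLGroupType d) (M : lpregroupType d') : Type :=
  (H * M)%type.

Section LexProd.
Context d d' (H : totalLGroupType d) (M : lpregroupType d').
Local Notation HM := (lexprod H M).
Implicit Types x y z : HM.

HB.instance Definition _ := Choice.on HM.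

Definition lexprod_le x y := (x.1 < y.1) || (x.1 == y.1) && (x.2 <= y.2).

Definition lexprod_meet x y : HM :=
  if x.1 < y.1 then x else if y.1 < x.1 then y else (x.1, x.2 `&` y.2).

Definition lexprod_join x y : HM :=
  if x.1 < y.1 then y else if y.1 < x.1 then x else (x.1, x.2 `|` y.2).

Definition lexprod_one : HM := (1, 1).
Definition lexprod_mul x y : HM := (x.1 * y.1, x.2 * y.2).
Definition lexprod_ladj x : HM := (ladj x.1, ladj x.2).
Definition lexprod_radj x : HM := (radj x.1, radj x.2).

Fact lexprod_le_refl : reflexive lexprod_le.
Proof. by move=> x; rewrite /lexprod_le eqxx lexx orbT. Qed.

Fact lexprod_le_anti : antisymmetric lexprod_le.
Proof.
move=> [a b] [a' b']; rewrite /lexprod_le /=.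
by case: (ltgtP a a') => //= -> /le_anti ->.
Qed.

Fact lexprod_le_trans : transitive lexprod_le.
Proof.
move=> [a b] [a' b'] [a'' b'']; rewrite /lexprod_le /=.
case: (ltgtP a' a) => //= [a'a _|->].
  case: (ltgtP a a'') => //= [aa'' _|<- _]; last by rewrite a'a.
  by rewrite (lt_trans a'a aa'').
by case: (ltgtP a a'') => //= _; exact: le_trans.
Qed.

HB.instance Definition _ := Order.Le_isPOrder.Build d' HM
  lexprod_le_refl lexprod_le_anti lexprod_le_trans.

Fact lexprod_meetP x y z :
  (x <= lexprod_meet y z) = (x <= y) && (x <= z).
Proof.
rewrite /Order.le /= /lexprod_le /lexprod_meet.
case: x y z => [a b] [a' b'] [a'' b''] /=.
case: (ltgtP a' a'') => [lt|lt|<-] /=.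
- case: (ltgtP a a') => //= [h|->]; first by rewrite (lt_trans h lt).
  by rewrite lt andbT.
- case: (ltgtP a a'') => /= [h|h|->]; rewrite ?andbF ?andbT //.
    by rewrite (lt_trans h lt).
  by rewrite lt.
- by case: (ltgtP a a') => //= _; exact: lexI.
Qed.

Fact lexprod_joinP x y z :
  (lexprod_join x y <= z) = (x <= z) && (y <= z).
Proof.
rewrite /Order.le /= /lexprod_le /lexprod_join.
case: x y z => [a b] [a' b'] [a'' b''] /=.
case: (ltgtP a a') => [lt|lt|<-] /=.
- case: (ltgtP a' a'') => /= [h|h|<-]; rewrite ?andbF ?andbT //.
    by rewrite (lt_trans lt h).
  by rewrite lt.
- case: (ltgtP a a'') => //= [h|<-]; first by rewrite (lt_trans lt h).
  by rewrite lt andbT.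
- by case: (ltgtP a a'') => //= _; exact: leUx.
Qed.

HB.instance Definition _ := Order.POrder_MeetJoin_isLattice.Build d' HM
  lexprod_meetP lexprod_joinP.

Fact lexprod_mulA : associative lexprod_mul.
Proof. by move=> x y z; rewrite /lexprod_mul /= !mulgA. Qed.

Fact lexprod_mul1g : left_id lexprod_one lexprod_mul.
Proof. by move=> [a b]; rewrite /lexprod_mul /= !mul1g. Qed.

Fact lexprod_mulg1 : right_id lexprod_one lexprod_mul.
Proof. by move=> [a b]; rewrite /lexprod_mul /= !mulg1. Qed.

HB.instance Definition _ :=
  isMonoid.Build HM lexprod_mulA lexprod_mul1g lexprod_mulg1.

Let ladjVg (h : H) : ladj h * h = 1.
Proof.
apply: le_anti; rewrite ladj_mul_le1 /=.
by rewrite {1}ladj_radj radj_mul_ge1.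
Qed.

Let ladjgV (h : H) : h * ladj h = 1.
Proof.
apply: le_anti; rewrite mul_ladj_ge1 andbT.
by rewrite ladj_radj mul_radj_le1.
Qed.

Let mulIl (h : H) : injective (fun g : H => g * h).
Proof.
by move=> a b /(congr1 (fun g => g * ladj h)); rewrite /= -!mulgA ladjgV !mulg1.
Qed.

Let mulIr (h : H) : injective (fun g : H => h * g).
Proof.
by move=> a b /(congr1 (fun g => ladj h * g)); rewrite /= !mulgA ladjVg !mul1g.
Qed.

Fact lexprod_lemul2r z x y : x <= y -> x * z <= y * z.
Proof.
move: x y z => [a b] [a' b'] [c e].
rewrite /Order.le /= /lexprod_le /= => /orP[aa'|/andP[/eqP-> bb']].
  rewrite lt_neqAle (lemul2r _ (ltW aa')) andbT (inj_eq (@mulIl c)).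
  by rewrite (lt_eqF aa').
by rewrite eqxx (lemul2r _ bb') orbT.
Qed.

Fact lexprod_lemul2l z x y : x <= y -> z * x <= z * y.
Proof.
move: x y z => [a b] [a' b'] [c e].
rewrite /Order.le /= /lexprod_le /= => /orP[aa'|/andP[/eqP-> bb']].
  rewrite lt_neqAle (lemul2l _ (ltW aa')) andbT (inj_eq (@mulIr c)).
  by rewrite (lt_eqF aa').
by rewrite eqxx (lemul2l _ bb') orbT.
Qed.

Fact lexprod_ladj_mul_le1 x : lexprod_ladj x * x <= (1 : HM).
Proof. by rewrite /Order.le /= /lexprod_le /= ladjVg eqxx ladj_mul_le1 orbT. Qed.

Fact lexprod_mul_ladj_ge1 x : (1 : HM) <= x * lexprod_ladj x.
Proof. by rewrite /Order.le /= /lexprod_le /= ladjgV eqxx mul_ladj_ge1 orbT. Qed.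

Fact lexprod_mul_radj_le1 x : x * lexprod_radj x <= (1 : HM).
Proof.
by rewrite /Order.le /= /lexprod_le /= -ladj_radj ladjgV eqxx mul_radj_le1 orbT.
Qed.

Fact lexprod_radj_mul_ge1 x : (1 : HM) <= lexprod_radj x * x.
Proof.
by rewrite /Order.le /= /lexprod_le /= -ladj_radj ladjVg eqxx radj_mul_ge1 orbT.
Qed.

HB.instance Definition _ := isLPregroup.Build d' HM
  lexprod_lemul2r lexprod_lemul2l lexprod_ladj_mul_le1
  lexprod_mul_ladj_ge1 lexprod_mul_radj_le1 lexprod_radj_mul_ge1.

End LexProd.

Definition FZ_mem : {pred int -> int} := fun f =>
  `[< {homo f : x y / (x <= y)%R} /\ forall x, finite_set (f @^-1` [set x]) >].

(* The order on FZ is inherited from the pointwise order of boolp on        *)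
(* int -> int.                                                              *)
Record FZ : predArgType := MkFZ { FZ_fun :> int -> int; _ : FZ_fun \in FZ_mem }.

HB.instance Definition _ := [isSub for FZ_fun].
HB.instance Definition _ := [Choice of FZ by <:].

Lemma FZ_homo (f : FZ) : {homo f : x y / (x <= y)%R}.
Proof. by case: f => f /= /asboolP[]. Qed.

Lemma FZ_fin (f : FZ) x : finite_set (f @^-1` [set x]).
Proof. by case: f => f /= /asboolP[]. Qed.

Lemma FZ_meet_closed : meet_closed FZ_mem.
Proof.
move=> f g /asboolP[fh ff] /asboolP[gh gf]; apply/asboolP; split=> [x y xy|x].
  rewrite !meetfE lexI (le_trans (leIl _ _) (fh _ _ xy)).
  by rewrite (le_trans (leIr _ _) (gh _ _ xy)).
apply: (@sub_finite_set _ _ ((f @^-1` [set x]) `|` (g @^-1` [set x])));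
  last by rewrite finite_setU.
move=> y /=; rewrite meetfE meetEtotal minElt; case: ifP => _ <-; by [left|right].
Qed.

Lemma FZ_join_closed : join_closed FZ_mem.
Proof.
move=> f g /asboolP[fh ff] /asboolP[gh gf]; apply/asboolP; split=> [x y xy|x].
  rewrite !joinfE leUx (le_trans (fh _ _ xy) (leUl _ _)).
  by rewrite (le_trans (gh _ _ xy) (leUr _ _)).
apply: (@sub_finite_set _ _ ((f @^-1` [set x]) `|` (g @^-1` [set x])));
  last by rewrite finite_setU.
move=> y /=; rewrite joinfE joinEtotal maxElt; case: ifP => _ <-; by [left|right].
Qed.

HB.instance Definition _ := Order.SubChoice_isSubLattice.Build _ (int -> int)
  FZ_mem FunOrder.fun_display FZ FZ_meet_closed FZ_join_closed.

Lemma FZ_leP (f g : FZ) : reflect (forall x, (f x <= g x)%R) (f <= g).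
Proof. by rewrite -Order.le_val; exact: lefP. Qed.

Lemma FZ_comp_subproof (f g : FZ) : f \o g \in FZ_mem.
Proof.
apply/asboolP; split=> [x y xy /=|x]; first by apply/FZ_homo/FZ_homo.
apply: (@sub_finite_set _ _
  (\bigcup_(y in f @^-1` [set x]) (g @^-1` [set y]))).
  by move=> z /= zx; exists (g z).
by apply: bigcup_finite => *; exact: FZ_fin.
Qed.

Lemma FZ_id_subproof : id \in FZ_mem.
Proof.
apply/asboolP; split=> // x.
by apply: (@sub_finite_set _ _ [set x]) => //; exact: finite_set1.
Qed.

Definition FZ_one : FZ := MkFZ FZ_id_subproof.
Definition FZ_mul (f g : FZ) : FZ := MkFZ (FZ_comp_subproof f g).

Fact FZ_mulA : associative FZ_mul.
Proof. by move=> f g h; apply: val_inj. Qed.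

Fact FZ_mul1g : left_id FZ_one FZ_mul.
Proof. by move=> f; apply: val_inj. Qed.

Fact FZ_mulg1 : right_id FZ_one FZ_mul.
Proof. by move=> f; apply: val_inj. Qed.

HB.instance Definition _ := isMonoid.Build FZ FZ_mulA FZ_mul1g FZ_mulg1.

Definition is_min (A : set int) : set int :=
  [set p | A p /\ forall p', A p' -> (p <= p')%R].
Definition is_max (A : set int) : set int :=
  [set p | A p /\ forall p', A p' -> (p' <= p)%R].

(* The default value 0 is never used: see FZ_ladjP and FZ_radjP. *)
Definition FZ_ladj_fun (f : int -> int) (q : int) : int :=
  xget 0%R (is_min [set p | (q <= f p)%R]).
Definition FZ_radj_fun (f : int -> int) (q : int) : int :=
  xget 0%R (is_max [set p | (f p <= q)%R]).

Lemma FZ_ub (f : FZ) (q : int) : exists p, (q <= f p)%R.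
Proof.
suff H (n : nat) : exists p, (f 0 + n%:Z <= f p)%R.
  by have [p ?] := H `|(q - f 0)%R|%N; exists p; lia.
elim: n => [|n [p np]]; first by exists 0%R; lia.
apply: contrapT => /forallNP N.
have: finite_set (range (fun m : nat => (p + m%:Z)%R)).
  apply: sub_finite_set (FZ_fin f (f p)) => _ [m _ <-] /=.
  have := N (p + m%:Z)%R; have := @FZ_homo f p (p + m%:Z)%R; lia.
move/(finite_image (fun z : int => absz (z - p)%R)).
rewrite image_comp => fin; apply: infinite_nat.
apply: sub_finite_set fin => m _; exists m => //=.
by rewrite addrAC subrr add0r.
Qed.

Lemma FZ_lb (f : FZ) (q : int) : exists p, (f p <= q)%R.
Proof.
suff H (n : nat) : exists p, (f p <= f 0 - n%:Z)%R.
  by have [p ?] := H `|(q - f 0)%R|%N; exists p; lia.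
elim: n => [|n [p np]]; first by exists 0%R; lia.
apply: contrapT => /forallNP N.
have: finite_set (range (fun m : nat => (p - m%:Z)%R)).
  apply: sub_finite_set (FZ_fin f (f p)) => _ [m _ <-] /=.
  have := N (p - m%:Z)%R; have := @FZ_homo f (p - m%:Z)%R p; lia.
move/(finite_image (fun z : int => absz (z - p)%R)).
rewrite image_comp => fin; apply: infinite_nat.
apply: sub_finite_set fin => m _; exists m => //=.
by rewrite addrAC subrr add0r abszN.
Qed.

Lemma FZ_ladjP (f : FZ) q : is_min [set p | (q <= f p)%R] (FZ_ladj_fun f q).
Proof.
apply: xgetPex; have [u qu] := FZ_ub f q; have [l lq] := FZ_lb f (q - 1)%R.
have ex : exists n : nat, (q <= f (l + n%:Z))%R.
  exists `|u - l|%N; apply: le_trans qu _; apply: FZ_homo; lia.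
case: (ex_minnP ex) => n qn minn; exists (l + n%:Z)%R; split=> //= p qp.
have lp : (l < p)%R by rewrite ltNge; apply/negP => /(@FZ_homo f); lia.
have := minn `|p - l|%N; have -> : (l + `|p - l|%N%:Z = p)%R by lia.
by move/(_ qp); lia.
Qed.

Lemma FZ_radjP (f : FZ) q : is_max [set p | (f p <= q)%R] (FZ_radj_fun f q).
Proof.
apply: xgetPex; have [u qu] := FZ_lb f q; have [l lq] := FZ_ub f (q + 1)%R.
have ex : exists n : nat, (f (l - n%:Z) <= q)%R.
  exists `|u - l|%N; apply: le_trans _ qu; apply: FZ_homo; lia.
case: (ex_minnP ex) => n qn minn; exists (l - n%:Z)%R; split=> //= p qp.
have lp : (p < l)%R by rewrite ltNge; apply/negP => /(@FZ_homo f); lia.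
have := minn `|p - l|%N; have -> : (l - `|p - l|%N%:Z = p)%R by lia.
by move/(_ qp); lia.
Qed.

Lemma FZ_ladj_adj (f : FZ) q p : (FZ_ladj_fun f q <= p)%R = (q <= f p)%R.
Proof.
have [/= qf fmin] := FZ_ladjP f q; apply/idP/idP => [|/fmin//].
by move/(@FZ_homo f); exact: le_trans.
Qed.

Lemma FZ_radj_adj (f : FZ) q p : (p <= FZ_radj_fun f q)%R = (f p <= q)%R.
Proof.
have [/= qf fmax] := FZ_radjP f q; apply/idP/idP => [|/fmax//].
by move/(@FZ_homo f)/le_trans; apply.
Qed.

Lemma finite_set_itvoc (a b : int) : finite_set [set q : int | (a < q <= b)%R].
Proof.
apply: (@sub_finite_set _ _
  ((fun n : nat => (a + n%:Z)%R) @` `I_(`|b - a|.+1)%N)).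
  by move=> q /= aqb; exists `|q - a|%N => /=; lia.
exact/finite_image/finite_II.
Qed.

Lemma FZ_ladj_subproof (f : FZ) : FZ_ladj_fun f \in FZ_mem.
Proof.
apply/asboolP; split=> [x y xy|x].
  by rewrite FZ_ladj_adj (le_trans xy) // -FZ_ladj_adj.
apply: sub_finite_set (finite_set_itvoc (f (x - 1)) (f x))%R => q /= qx.
have := FZ_ladj_adj f q x; have := FZ_ladj_adj f q (x - 1)%R; lia.
Qed.

Lemma FZ_radj_subproof (f : FZ) : FZ_radj_fun f \in FZ_mem.
Proof.
apply/asboolP; split=> [x y xy|x].
  by rewrite FZ_radj_adj (le_trans _ xy) // -FZ_radj_adj.
apply: sub_finite_set (finite_set_itvoc (f x - 1) (f (x + 1)))%R => q /= qx.
have := FZ_radj_adj f q x; have := FZ_radj_adj f q (x + 1)%R; lia.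
Qed.

Definition FZ_ladj (f : FZ) : FZ := MkFZ (FZ_ladj_subproof f).
Definition FZ_radj (f : FZ) : FZ := MkFZ (FZ_radj_subproof f).

Fact FZ_lemul2r (h f g : FZ) : f <= g -> f * h <= g * h.
Proof. by move=> /FZ_leP fg; apply/FZ_leP => x; exact: fg. Qed.

Fact FZ_lemul2l (h f g : FZ) : f <= g -> h * f <= h * g.
Proof. by move=> /FZ_leP fg; apply/FZ_leP => x; apply/FZ_homo/fg. Qed.

Fact FZ_ladj_mul_le1 f : FZ_ladj f * f <= (1 : FZ).
Proof. by apply/FZ_leP => x /=; rewrite FZ_ladj_adj. Qed.

Fact FZ_mul_ladj_ge1 f : (1 : FZ) <= f * FZ_ladj f.
Proof. by apply/FZ_leP => x /=; rewrite -FZ_ladj_adj. Qed.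

Fact FZ_mul_radj_le1 f : f * FZ_radj f <= (1 : FZ).
Proof. by apply/FZ_leP => x /=; rewrite -FZ_radj_adj. Qed.

Fact FZ_radj_mul_ge1 f : (1 : FZ) <= FZ_radj f * f.
Proof. by apply/FZ_leP => x /=; rewrite FZ_radj_adj. Qed.

HB.instance Definition _ := isLPregroup.Build _ FZ
  FZ_lemul2r FZ_lemul2l FZ_ladj_mul_le1
  FZ_mul_ladj_ge1 FZ_mul_radj_le1 FZ_radj_mul_ge1.

Definition FkZ (k : nat) := periodic_sub FZ k.

HB.instance Definition _ k := LPregroup.copy (FkZ k) (periodic_sub FZ k).

(* Main.v *)
Require Import Defs.
From HB Require Import structures.
From mathcomp Require Import all_boot all_order ssralg ssrnum ssrint intdiv.
From mathcomp Require Import zify.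
From mathcomp Require Import boolp classical_sets cardinality.

Set Implicit Arguments.
Unset Strict Implicit.
Unset Printing Implicit Defensive.

Import Order.TTheory GRing.Theory Num.Theory.

(** The double adjoint [s x := x^(ll)] is an automorphism of [L] and [s ^ n] is the
    identity. The join of the [s]-orbit of [x] is therefore invertible: it is the
    least invertible element above [x], written [ceil x]. So the totally ordered
    abelian group [G] of invertible elements bounds all of [L], and a meet
    distributes over any join whose value lies in [G] ([meet_lub_le]).

    Local structure. Since [L] is proper it contains a closure: some [b > 1] with
    [b * b <= b]. No invertible element other than 1 lies between 1 and a closure
    ([closure_invertible_le1]). Taking meets of conjugates [s^i b] one arrives at
    an element [a > 1] whose orbit consists of [k > 1] pairwise orthogonal
    elements [a_i := s^i a], indexed modulo [k]; choose [k] maximal. In F_k(Z) the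
    map [a_i] sends the points congruent to [i] to their successors and fixes the
    others. From [x /\ y = 1 -> s x * y <= s x \/ y] one gets that [a_j * a_i] is
    just a join unless [j = i + 1], hence [t := ceil a] satisfies
    [t * a_i = a_(i+1) * t]. Because [G] is totally ordered, conjugation by any
    element of [G] permutes the [a_i] cyclically, and this forces [t] to be the
    least element above 1 in [G] ([t_least]). Maximality of [k] makes the [a_i]
    atoms.

    Action on points. Let [A := a_(k-1) * ... * a_1], which in F_k(Z) rounds up to
    the next multiple of [k]. Every [x] satisfies [x * A = g * A] for exactly one
    [g] in [G] ([max_closure_action]), so [L] acts on [G] from the left. The
    action is faithful, since the conjugates of [A] by the powers of [t] meet in
    1 ([max_closure_faithful]).

    Global structure. The powers of [t] form a convex subgroup of [G]. The quotient
    is torsion-free by convexity and finitely generated because [L] is, hence it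
    is free. So [G] is the direct sum of these powers and of a complement [H], and
    the basis of [H] can be corrected by powers of [t] so that [H] commutes with
    [a] ([exists_complement]). Then
    [x * t^j * A = h * t^(phi j) * A] defines a component [h] in [H], which does
    not depend on [j], and a map [phi] in F_k(Z). The map sending [x] to [(h, phi)]
    is the isomorphism; it is onto because [phi] is the meet of the maps
    [t^(phi j) * A * t^(-j)] over one period. *)

(** * Residuation and the double adjoint *)

Section Residuation.
Local Open Scope group_scope.
Local Open Scope order_scope.
Context d (L : lpregroupType d).
Implicit Types x y z a b u v w : L.

Lemma mul_le_radj x y z : (x * y <= z) = (y <= radj x * z).
Proof.
apply/idP/idP => [h|h].
  rewrite -[y]mul1g; apply: le_trans (lemul2r _ (radj_mul_ge1 x)) _.
  by rewrite -mulgA; exact: lemul2l.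
apply: le_trans (lemul2l x h) _.
by rewrite mulgA -[leRHS]mul1g; apply/lemul2r/mul_radj_le1.
Qed.

Lemma mul_le_ladj x y z : (x * y <= z) = (x <= z * ladj y).
Proof.
apply/idP/idP => [h|h].
  rewrite -[x]mulg1; apply: le_trans (lemul2l _ (mul_ladj_ge1 y)) _.
  by rewrite mulgA; exact: lemul2r.
apply: le_trans (lemul2r y h) _.
by rewrite -mulgA -[leRHS]mulg1; apply/lemul2l/ladj_mul_le1.
Qed.

Lemma le_mul_ladj x y z : (z <= x * y) = (ladj x * z <= y).
Proof. by rewrite mul_le_radj ladjK. Qed.

Lemma le_mul_radj x y z : (z <= x * y) = (z * radj y <= x).
Proof. by rewrite mul_le_ladj radjK. Qed.

Lemma mulgUr x y z : x * (y `|` z) = x * y `|` x * z.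
Proof.
apply: le_anti; rewrite mul_le_radj !leUx -!mul_le_radj leUl leUr /=.
by rewrite !lemul2l ?leUl ?leUr.
Qed.

Lemma mulgUl x y z : (y `|` z) * x = y * x `|` z * x.
Proof.
apply: le_anti; rewrite mul_le_ladj !leUx -!mul_le_ladj leUl leUr /=.
by rewrite !lemul2r ?leUl ?leUr.
Qed.

Lemma mulgIr x y z : x * (y `&` z) = x * y `&` x * z.
Proof.
apply: le_anti; apply/andP; split.
  by rewrite lexI !lemul2l ?leIl ?leIr.
by rewrite le_mul_ladj lexI -!le_mul_ladj leIl leIr.
Qed.

Lemma mulgIl x y z : (y `&` z) * x = y * x `&` z * x.
Proof.
apply: le_anti; apply/andP; split.
  by rewrite lexI !lemul2r ?leIl ?leIr.
by rewrite le_mul_radj lexI -!le_mul_radj leIl leIr.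
Qed.

(** As in lattice-ordered groups: the right-hand side expands into four terms,
    each of them above [y `&` a * b]. *)
Lemma meet_mul_le y a b : 1 <= y -> 1 <= a -> 1 <= b ->
  y `&` a * b <= (y `&` a) * (y `&` b).
Proof.
move=> y1 a1 b1; rewrite mulgIr !mulgIl !lexI leIr andbT.
rewrite !(le_trans (leIl _ _)) //.
- by rewrite -{1}[y]mulg1 lemul2l.
- by rewrite -{1}[y]mul1g lemul2r.
- by rewrite -{1}[y]mul1g lemul2r.
Qed.

Lemma orthM y a b : 1 <= y -> 1 <= a -> 1 <= b ->
  y `&` a <= (1 : L) -> y `&` b <= (1 : L) -> y `&` a * b <= (1 : L).
Proof.
move=> y1 a1 b1 ya yb; apply: le_trans (meet_mul_le y1 a1 b1) _.
by rewrite -[leRHS]mul1g; exact: lemul2.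
Qed.

(** The double adjoint is an automorphism; in a periodic l-pregroup it has
    finite order, and its fixed points are the invertible elements. *)
Definition dadj x := ladj (ladj x).

Lemma le_dadj x y : (dadj x <= dadj y) = (x <= y).
Proof.
apply/idP/idP => [h|]; last by move=> h; rewrite !le_ladj.
by rewrite -[x]ladjK -[y]ladjK le_radj // -[ladj y]ladjK -[ladj x]ladjK le_radj.
Qed.

Lemma dadjM x y : dadj (x * y) = dadj x * dadj y.
Proof. by rewrite /dadj !ladjM. Qed.

Lemma dadjI x y : dadj (x `&` y) = dadj x `&` dadj y.
Proof. by rewrite /dadj ladjI ladjU. Qed.

Lemma dadj1 : dadj (1 : L) = 1.
Proof. by rewrite /dadj !ladj1. Qed.

Definition dadjn i x := iter i dadj x.

Lemma dadjnD i j x : dadjn (i + j) x = dadjn i (dadjn j x).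
Proof. exact: iterD. Qed.

Lemma dadjnS i x : dadjn i.+1 x = dadj (dadjn i x).
Proof. by []. Qed.

Lemma dadjnC i j x : dadjn i (dadjn j x) = dadjn j (dadjn i x).
Proof. by rewrite -!dadjnD addnC. Qed.

Lemma le_dadjn i x y : (dadjn i x <= dadjn i y) = (x <= y).
Proof. by elim: i => //= i; rewrite le_dadj. Qed.

Lemma dadjn_inj i : injective (dadjn i).
Proof. by move=> x y xy; apply: le_anti;
  rewrite -[x <= y](le_dadjn i) -[y <= x](le_dadjn i) xy lexx. Qed.

Lemma dadjnM i x y : dadjn i (x * y) = dadjn i x * dadjn i y.
Proof. by elim: i => //= i ->; rewrite dadjM. Qed.

Lemma dadjnI i x y : dadjn i (x `&` y) = dadjn i x `&` dadjn i y.
Proof. by elim: i => //= i ->; rewrite dadjI. Qed.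

Lemma dadjn1 i : dadjn i (1 : L) = 1.
Proof. by elim: i => //= i ->; rewrite dadj1. Qed.

Lemma dadjn_ge1 i x : (1 <= dadjn i x) = (1 <= x).
Proof. by rewrite -{1}(dadjn1 i) le_dadjn. Qed.

(** Orthogonality makes products collapse to joins, but only after moving one
    factor by the double adjoint: this asymmetry is what makes the orbit of an
    orthogonal element behave like the covers of the identity in F_k(Z). *)
Lemma dadj_mul_orth x y : x `&` y <= 1 -> dadj x * y <= dadj x `|` y.
Proof.
move=> /le_ladj; rewrite ladj1 ladjI => /(lemul2r y) /(lemul2l (dadj x)).
rewrite mul1g mulgUl mulgUr => /le_trans; apply.
rewrite joinC leU2 //.
  by rewrite -[leRHS]mulg1; exact/lemul2l/ladj_mul_le1.
by rewrite mulgA -[leRHS]mul1g; exact/lemul2r/ladj_mul_le1.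
Qed.

(** ** Invertible elements *)

Definition invertible x := ladj x = radj x.

Lemma invertibleVg x : invertible x -> ladj x * x = 1.
Proof.
by move=> xE; apply: le_anti; rewrite ladj_mul_le1 {1}xE radj_mul_ge1.
Qed.

Lemma invertiblegV x : invertible x -> x * ladj x = 1.
Proof.
by move=> xE; apply: le_anti; rewrite mul_ladj_ge1 {1}xE mul_radj_le1.
Qed.

Lemma invertible1 : invertible (1 : L).
Proof. by rewrite /invertible ladj1 radj1. Qed.

Lemma invertibleM x y : invertible x -> invertible y -> invertible (x * y).
Proof. by rewrite /invertible ladjM radjM => -> ->. Qed.

Lemma invertibleV x : invertible x -> invertible (ladj x).
Proof. by move=> xE; rewrite /invertible ladjK {1}xE radjK. Qed.

Lemma invertibleX x i : invertible x -> invertible (x ^+ i).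
Proof.
move=> xE; elim: i => [|i IHi]; first exact: invertible1.
by rewrite expgS; exact: invertibleM.
Qed.

Lemma dadj_invertible x : invertible x -> dadj x = x.
Proof. by rewrite /dadj => ->; rewrite radjK. Qed.

Lemma invertible_dadj x : dadj x = x -> invertible x.
Proof. by rewrite /invertible => {2}<-; rewrite ladjK. Qed.

Lemma dadjn_invertible i x : invertible x -> dadjn i x = x.
Proof. by move=> xE; elim: i => //= i ->; exact: dadj_invertible. Qed.

Lemma invertible_leMl x y z : invertible x -> (x * y <= x * z) = (y <= z).
Proof.
by move=> xE; rewrite mul_le_radj -xE mulgA invertibleVg // mul1g.
Qed.

Lemma invertible_leMr x y z : invertible x -> (y * x <= z * x) = (y <= z).
Proof.
by move=> xE; rewrite mul_le_ladj -mulgA invertiblegV // mulg1.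
Qed.

Lemma invertible_mulKl x : invertible x -> cancel (mul x) (mul (ladj x)).
Proof. by move=> xE y; rewrite mulgA invertibleVg // mul1g. Qed.

Lemma invertible_mulVKl x : invertible x -> cancel (mul (ladj x)) (mul x).
Proof. by move=> xE y; rewrite mulgA invertiblegV // mul1g. Qed.

(** ** Least upper bounds of orbits *)

Definition is_lub (f : nat -> L) u := forall y, u <= y <-> forall i, f i <= y.

Lemma lub_ge f u i : is_lub f u -> f i <= u.
Proof. by move=> fu; have /fu := lexx u. Qed.

(** A meet distributes over a join [u] that is invertible: from
    [f i * (1 `&` radj (f i) * a) <= f i `&` a <= c] one gets
    [f i <= c * (1 `|` ladj a * u)], hence the same for [u], and
    [u * radj u = 1] lets one go back. *)
Lemma meet_lub_le a f u c : invertible u -> is_lub f u ->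
  (forall i, a `&` f i <= c) -> a `&` u <= c.
Proof.
move=> uE fu ac.
have H v : v * (1 `&` radj v * a) <= c <-> v <= c * (1 `|` ladj a * v).
  by rewrite mul_le_ladj ladjI ladj1 ladjM radjK.
have /H : u <= c * (1 `|` ladj a * u).
  apply/fu => i; apply: le_trans (_ : c * (1 `|` ladj a * f i) <= _).
    apply/H; apply: le_trans (ac i); rewrite mulgIr mulg1 mulgA meetC leI2 //.
    by rewrite -[leRHS]mul1g lemul2r // mul_radj_le1.
  by rewrite lemul2l // leU2 // lemul2l // (lub_ge i fu).
by rewrite mulgIr mulg1 mulgA -uE invertiblegV // mul1g meetC.
Qed.

End Residuation.

(** * Periodic l-pregroups: orbits of the double adjoint *)

Section Periodic.
Local Open Scope group_scope.
Local Open Scope order_scope.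
Context (n : nat) (n_gt0 : (0 < n)%N) d (L : lpregroupType d).
Hypothesis Lper : forall x : L, dadjn n x = x.
Implicit Types x y z w a g h : L.

Lemma dadjn_mod i x : dadjn (i %% n) x = dadjn i x.
Proof.
rewrite [in RHS](divn_eq i n) addnC dadjnD; congr dadjn.
by elim: (_ %/ _) => // q IHq; rewrite mulSn dadjnD -IHq Lper.
Qed.

Lemma dadjn_fix i x : x <= dadjn i x -> dadjn i x = x.
Proof.
move=> xi; apply: le_anti; rewrite xi andbT.
have xm m : x <= dadjn (m * i) x.
  elim: m => // m IHm; rewrite mulSn dadjnD.
  by apply: le_trans xi _; rewrite le_dadjn.
have := xm n.-1; rewrite -(le_dadjn i) -dadjnD -mulSn prednK // => /le_trans;
  apply.
by rewrite -dadjn_mod modnMr.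
Qed.

(** The join of the orbit of [x], which is the least invertible element above
    [x]: there are enough invertible elements to bound everything. *)
Definition ceil x := iter n (fun y => x `|` dadj y) x.

Lemma ceil_lub x : is_lub (fun i => dadjn i x) (ceil x).
Proof.
move=> y; suff H m z : iter m (fun y => x `|` dadj y) x <= z <->
    forall i, (i <= m)%N -> dadjn i x <= z.
  split=> [/H h i|h]; last by apply/H => i _; exact: h.
  by rewrite -dadjn_mod h // ltnW // ltn_pmod.
elim: m z => [|m IHm] z /=; first by split=> [? [|]//|/(_ 0%N)]; exact.
have zE : z = dadj (radj (radj z)) by rewrite /dadj !radjK.
rewrite leUx; split=> [/andP[xz] + [//|i] im|h]; last first.
  rewrite (h 0%N) //= zE le_dadj; apply/IHm => i im.
  by rewrite -le_dadj -zE; exact: (h i.+1).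
by rewrite zE le_dadj => /IHm/(_ i im); rewrite dadjnS le_dadj.
Qed.

Lemma ceil_dadjn_ge i x : dadjn i x <= ceil x.
Proof. exact: lub_ge i (ceil_lub x). Qed.

Lemma ceil_ge x : x <= ceil x.
Proof. exact: ceil_dadjn_ge 0%N x. Qed.

Lemma ceil_invertible x : invertible (ceil x).
Proof.
apply/invertible_dadj/(@dadjn_fix 1)/ceil_lub => i.
rewrite -[dadjn i x]Lper -(prednK n_gt0) dadjnS /= le_dadj -dadjnD.
exact: ceil_dadjn_ge.
Qed.

Lemma ceil_le x g : invertible g -> (ceil x <= g) = (x <= g).
Proof.
move=> gE; apply/idP/idP => [|xg]; first exact/le_trans/ceil_ge.
by apply/ceil_lub => i; rewrite -(dadjn_invertible i gE) le_dadjn.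
Qed.

Definition floor x := radj (ceil (ladj x)).

Lemma floor_invertible x : invertible (floor x).
Proof. by rewrite /floor -ceil_invertible;
  exact/invertibleV/ceil_invertible. Qed.

Lemma le_floor x g : invertible g -> (g <= floor x) = (g <= x).
Proof.
move=> gE; have gVE := invertibleV gE; apply/idP/idP.
  move/le_ladj; rewrite radjK ceil_le // => /le_radj.
  by rewrite !ladjK.
by move/le_ladj; rewrite -(ceil_le _ gVE) => /le_radj; rewrite ladjK.
Qed.

Lemma floor_le x : floor x <= x.
Proof. by rewrite -le_floor //; exact: floor_invertible. Qed.

(** With [u := ceil a], the inequality to be proved is [u <= ladj g * u]. As the
    right-hand side is invertible, it suffices that [dadj a * ladj u <= ladj g];
    and [ladj u <= ladj a], while [dadj a * ladj a = ladj (a * ladj a)] is at most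
    [ladj a] because [a <= a * ladj a] is equivalent to [a * a <= a]. *)
Lemma closure_invertible_le1 a g : a * a <= a ->
  invertible g -> g <= a -> g <= 1.
Proof.
move=> aa gE ga; set u := ceil a; have uE := ceil_invertible a.
suff : u <= ladj g * u.
  by rewrite -(invertible_leMl _ _ gE) invertible_mulVKl // -[leRHS]mul1g
    invertible_leMr.
have iE : invertible (ladj g * u) by apply: invertibleM;
  first exact: invertibleV.
rewrite ceil_le // -le_dadj (dadj_invertible iE) -[u]radjK -mul_le_ladj.
rewrite -uE; apply: le_trans (_ : dadj a * ladj a <= _).
  by apply/lemul2l/le_ladj/ceil_ge.
by rewrite -ladjM le_ladj // (le_trans ga) // -mul_le_ladj.
Qed.

Lemma closure_leMr a g h : 1 <= a -> a * a <= a -> invertible g ->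
  invertible h -> (g * a <= h * a) = (g <= h).
Proof.
move=> a1 aa gE hE; apply/idP/idP => [ga|gh]; last exact: lemul2r.
rewrite -[h]mulg1 le_mul_ladj; apply: closure_invertible_le1 aa _ _.
  exact/invertibleM/gE/invertibleV.
by rewrite -le_mul_ladj; apply: le_trans ga; rewrite -{1}[g]mulg1 lemul2l.
Qed.

(** ** Elements with pairwise orthogonal conjugates *)

(** [f z := z `&` dadjn i z] either stabilizes under iteration at a fixed point
    of [dadjn i], or reaches the unit; the last value before the unit is then
    orthogonal to its image. *)
Lemma separate1 i z : 1 < z -> exists z', [/\ 1 < z', z' <= z,
  dadjn i z' = z' \/ z' `&` dadjn i z' <= 1 &
  forall j, dadjn j z = z \/ z `&` dadjn j z <= 1 ->
    dadjn j z' = z' \/ z' `&` dadjn j z' <= 1].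
Proof.
move=> z1; pose f w := w `&` dadjn i w.
have FP m w y : w <= iter m f y <-> forall l, (l <= m)%N ->
  w <= dadjn (i * l) y.
  elim: m y => [|m IHm] y.
    split=> [wy [|//] _|/(_ 0%N isT)]; by rewrite muln0.
  rewrite iterSr IHm; split=> [h [|l] lm|h l lm].
  - by have := h 0%N isT; rewrite muln0 /= => /le_trans; apply; exact: leIl.
  - rewrite mulnS addnC dadjnD; apply: le_trans (h l lm) _.
    by rewrite le_dadjn leIr.
  - rewrite /f dadjnI lexI -dadjnD addnC -mulnS.
    by rewrite !h // ltnW.
have Fge1 m : 1 <= iter m f z.
  by apply/FP => l _; rewrite dadjn_ge1 ltW.
have Fle m : iter m f z <= z.
  by have /FP/(_ 0%N isT) := lexx (iter m f z); rewrite muln0.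
have Fsep m j : dadjn j z = z \/ z `&` dadjn j z <= 1 ->
    dadjn j (iter m f z) = iter m f z \/
    iter m f z `&` dadjn j (iter m f z) <= 1.
  case=> [zj|zj]; [left|right]; last first.
    by apply: le_trans zj; apply: leI2; rewrite ?le_dadjn.
  elim: m => //= m IHm.
  by rewrite /f dadjnI dadjnC IHm.
have [all1|] := pselect (forall m, 1 < iter m f z).
  exists (iter n f z); split=> // [|j]; last exact: Fsep.
  left; apply: dadjn_fix.
  have : iter n f z <= iter n.+1 f z; last by move=> /= /le_trans; apply;
    exact: leIr.
  apply/FP => l; rewrite leq_eqVlt => /predU1P[->|]; last first.
    by have /FP h := lexx (iter n f z); exact: h.
  have /FP/(_ 1%N n_gt0) := lexx (iter n f z).
  by rewrite -[dadjn (i * n.+1) z]dadjn_mod [(i * n.+1)%N]mulnSr modnMDl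
    dadjn_mod muln1.
move/existsNP => ex.
have ex' : exists m, ~~ (1 < iter m f z) by have [m /negP] := ex; exists m.
case: (ex_minnP ex') => -[|m]; first by rewrite /= z1.
move=> Fm1 minm; exists (iter m f z); split=> //.
- by apply/negPn/negP => /minm; rewrite ltnn.
- by right; move: Fm1; rewrite lt_def Fge1 andbT negbK => /eqP/= fE;
  rewrite -[leLHS]/(f _) fE.
- by move=> j; exact: Fsep.
Qed.

(** In F_k(Z) such an element, with this [k > 1], moves one residue class modulo
    [k] up by one. *)
Definition orbital k z := [/\ 1 < z, (0 < k)%N, dadjn k z = z &
  forall i, ~~ (k %| i)%N -> z `&` dadjn i z <= 1].

Lemma orbital_dvd k z : orbital k z -> (k %| n)%N.
Proof.
case=> z1 _ _ zorth; apply/negPn/negP => /zorth.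
by rewrite Lper meetxx => /(lt_le_trans z1); rewrite ltxx.
Qed.

(** After separating by every [i < n] in turn, each conjugate of the resulting
    element is equal or orthogonal to it, and [k] is its least period. *)
Lemma exists_orbital y : 1 < y -> exists z k, z <= y /\ orbital k z.
Proof.
move=> y1; have [z [z1 zy zsep]] : exists z, [/\ 1 < z, z <= y & forall i,
    dadjn i z = z \/ z `&` dadjn i z <= 1].
  suff [z [z1 zy zsep]] : exists z, [/\ 1 < z, z <= y & forall i, (i < n)%N ->
      dadjn i z = z \/ z `&` dadjn i z <= 1].
    by exists z; split=> // i; rewrite -dadjn_mod; apply: zsep;
      rewrite ltn_pmod.
  elim: (n) => [|m [z [z1 zy zsep]]]; first by exists y.
  have [z' [z'1 z'z z'm z'sep]] := separate1 m z1.
  exists z'; split=> //; first exact: le_trans zy.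
  by move=> i; rewrite ltnS leq_eqVlt => /predU1P[->//|/zsep/z'sep].
have exk : exists k, (0 < k)%N && (dadjn k z == z).
  by exists n; rewrite n_gt0 Lper eqxx.
case: (ex_minnP exk) => k /andP[k0 /eqP zk] mink.
exists z, k; split=> //; split=> // i; case: (zsep i) => // zi.
rewrite /dvdn -lt0n => im; have : dadjn (i %% k) z = z.
  rewrite -{2}zi {2}(divn_eq i k) addnC dadjnD; congr dadjn.
  by elim: (_ %/ _) => // q IHq; rewrite mulSn addnC dadjnD zk.
by move=> zm; have := mink (i %% k);
  rewrite im zm eqxx leqNgt ltn_pmod // => /(_ isT).
Qed.

End Periodic.

(** * Complements of a cyclic subgroup in a finitely generated abelian group *)

Lemma subgroup_closed (A : zmodType) (C : A -> Prop) : C 0%R ->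
  (forall x y, C x -> C y -> C (x - y)%R) ->
  (forall x y, C x -> C y -> C (x + y)%R) /\
  (forall x (m : int), C x -> C (x *~ m)%R).
Proof.
move=> C0 CB; have CD x y : C x -> C y -> C (x + y)%R.
  by move=> Cx Cy; rewrite -[y]opprK -[(- y)%R]sub0r; apply/CB/CB.
split=> // x m Cx; have CN k : C (x *+ k)%R.
  by elim: k => // k IHk; rewrite mulrS; exact: CD.
case: m => k; first exact: CN.
by rewrite NegzE mulrNz -[(- _)%R]sub0r; apply: CB => //; exact: CN.
Qed.

Section Complement.
Local Open Scope ring_scope.
Context (A : zmodType) (t : A).
Implicit Types x y : A.

Hypothesis torsion_free : forall x (m : int), m != 0 ->
  (exists j, x *~ m = t *~ j) -> exists j, x = t *~ j.

Definition genmod r (g : 'I_r -> A) :=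
  forall x, exists c j, x = \sum_i g i *~ c i + t *~ j.

(** Adding to one generator a multiple of another one is compensated on the
    coefficients by a step of Euclid's algorithm. *)
Lemma sum_transvection r (g : 'I_r -> A) (c : 'I_r -> int) i l q : l != i ->
  \sum_p (if p == i then g i + g l *~ q else g p)
         *~ (if p == l then c l - q * c i else c p) = \sum_p g p *~ c p.
Proof.
move=> li; rewrite (bigD1 i) // [RHS](bigD1 i) //= (bigD1 l) // [X in _ = _ +
  X](bigD1 l) //=.
rewrite !eqxx eq_sym (negbTE li) !addrA; congr (_ + _).
  rewrite mulrzDl mulrzBr -!mulrzA -!addrA; congr (_ + _).
  by rewrite addrCA subrr addr0.
by apply: eq_bigr => p /andP[/negbTE -> /negbTE ->].
Qed.

(** Euclid's algorithm on the coefficients of a relation, always dividing by one of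
    least nonzero absolute value. When a single nonzero coefficient is left, the
    corresponding generator is a multiple of [t], because there is no torsion. *)
Lemma shrink_generators r (g : 'I_r.+1 -> A) c j : (exists i, c i != 0) ->
  \sum_i g i *~ c i = t *~ j -> genmod g -> exists g' : 'I_r -> A, genmod g'.
Proof.
have [N] := ubnP (\sum_i `|c i|)%N.
elim: N g c j => // N IHN g c j cN [i0 ci0] rel gen.
case: (@arg_minnP _ i0 (fun i => c i != 0) (fun i => `|c i|%N) ci0) =>
  i ci imin.
have [l /andP[li cl]|c0] := pickP (fun l => (l != i) && (c l != 0)).
  pose q := (c l %/ c i)%Z.
  pose c' p := if p == l then c l - q * c i else c p.
  apply: (IHN (fun p => if p == i then g i + g l *~ q else g p) c' j).
  - rewrite ltnS in cN; apply: leq_trans cN;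
    rewrite [X in (_ <= X)%N](bigD1 l) //.
    rewrite [X in (X < _)%N](bigD1 l) //= /c' eqxx -addSn leq_add //.
      apply: leq_trans (imin l cl).
      have -> : c l - q * c i = (c l %% c i)%Z.
        by rewrite {1}(divz_eq (c l) (c i)) addrAC subrr add0r.
      have := ltz_mod (c l) ci; have := modz_ge0 (c l) ci; lia.
    by rewrite leq_sum // => p /negbTE ->.
  - by exists i; rewrite /c' [i == l]eq_sym (negbTE li).
  - by rewrite sum_transvection.
  - move=> x; have [e [m ->]] := gen x.
    by exists (fun p => if p == l then e l - q * e i else e p), m;
      rewrite sum_transvection.
have /torsion_free : exists j, g i *~ c i = t *~ j.
  exists j; rewrite -rel (bigD1 i) //= big1 ?addr0 // => l li.
  by have := c0 l; rewrite li /= => /negbFE/eqP ->.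
move=> /(_ ci)[m gi]; exists (fun p => g (lift i p)) => x.
have [e [m' ->]] := gen x; exists (fun p => e (lift i p)), (m * e i + m').
by rewrite (bigD1_ord i) //= gi -mulrzA mulrzDr addrA; congr (_ + _);
  rewrite addrC.
Qed.

Lemma independent_generators r (g : 'I_r -> A) : genmod g ->
  exists r' (g' : 'I_r' -> A), genmod g' /\
    forall c j, \sum_i g' i *~ c i = t *~ j -> forall i, c i = 0.
Proof.
elim: r g => [|r IHr] g gen; first by exists 0%N, g; split=> // c j _ [].
have [ind|] := pselect (forall c j, \sum_i g i *~ c i = t *~ j -> forall i,
  c i = 0).
  by exists r.+1, g.
move=> /existsNP[c] /existsNP[j] /not_implyP[rel] /existsNP[i /eqP ci].
by have [g' /IHr] := shrink_generators (ex_intro _ i ci) rel gen.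
Qed.

(** The complement is spanned by a basis modulo [t], each element of which has
    been corrected by a multiple of [t] in order to lie in [C]. *)
Lemma exists_complement (C : A -> Prop) r (g : 'I_r -> A) : genmod g ->
  C 0 -> (forall x y, C x -> C y -> C (x - y)) ->
  (forall x, exists j, C (x - t *~ j)) ->
  exists H : A -> Prop, [/\ H 0, forall x y, H x -> H y -> H (x - y),
    forall x, H x -> C x, forall x, exists j, H (x - t *~ j) &
    forall j, H (t *~ j) -> t *~ j = 0].
Proof.
move=> /independent_generators[s [b [gen ind]]] C0 CB Ct.
have [CD CZ] := subgroup_closed C0 CB.
have [f fC] := choice (fun i => Ct (b i)).
pose h i := b i - t *~ f i.
have hE (c : 'I_s -> int) : \sum_i h i *~ c i =
    \sum_i b i *~ c i - t *~ (\sum_i f i * c i).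
  rewrite mulrz_sumr -sumrB; apply: eq_bigr => i _.
  by rewrite mulrzBl mulrzA.
exists (fun x => exists c, x = \sum_i h i *~ c i); split.
- by exists (fun=> 0); rewrite big1.
- move=> x y [c ->] [c' ->]; exists (fun i => c i - c' i).
  by rewrite -sumrB; apply: eq_bigr => i _; rewrite mulrzBr.
- by move=> x [c ->]; elim/big_ind: _ => // i _; exact/CZ/fC.
- move=> x; have [c [j ->]] := gen x; exists (j + \sum_i f i * c i), c.
  by rewrite hE mulrzDr opprD addrA addrK.
- move=> j [c cE]; have c0 : forall i, c i = 0.
    apply: (ind _ (j + \sum_i f i * c i)).
    by rewrite mulrzDr cE hE subrK.
  by rewrite cE big1 // => i _; rewrite c0.
Qed.

End Complement.

(** * Isomorphisms, totally ordered subgroups and periodic maps *)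

Section Isomorphism.
Local Open Scope group_scope.
Local Open Scope order_scope.

(** The lattice operations are determined by the order, and the adjoints by the
    order and the product. *)
Lemma lp_isomorphism_le d d' (L : lpregroupType d) (M : lpregroupType d')
    (f : L -> M) : bijective f -> {morph f : x y / x * y} ->
  (forall x y, (f x <= f y) = (x <= y)) -> lp_isomorphism f.
Proof.
move=> fbij fM fle; have [g gK fK] := fbij.
have gle x y : (g x <= g y) = (x <= y) by rewrite -fle !fK.
have f1 : f 1 = 1.
  by have := fM 1 (g 1); rewrite mul1g fK mulg1.
split=> //.
- move=> x y; apply: le_anti; rewrite lexI !fle leIl leIr /=.
  by rewrite -gle gK lexI -!fle fK leIl leIr.
- move=> x y; apply: le_anti; rewrite leUx !fle leUl leUr andbT.
  by rewrite -gle gK leUx -!fle fK leUl leUr.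
- by move=> x; apply: ladj_unique; rewrite -fM -f1 fle ?ladj_mul_le1
  ?mul_ladj_ge1.
- by move=> x; apply: radj_unique; rewrite -fM -f1 fle ?mul_radj_le1
  ?radj_mul_ge1.
Qed.

Lemma iter_adjP d (L : lpregroupType d) k (x : L) :
  iter k ladj x = iter k radj x <-> dadjn k x = x.
Proof.
have dE : dadjn k x = iter k ladj (iter k ladj x).
  by elim: k => // k IHk; rewrite dadjnS IHk [iter k.+1 ladj x]iterS -iterSr.
have K y : iter k radj (iter k ladj y) = y.
  by elim: k {dE} y => // k IHk y; rewrite iterSr iterS ladjK.
have K' y : iter k ladj (iter k radj y) = y.
  by elim: k {dE K} y => // k IHk y; rewrite iterSr iterS radjK.
by rewrite dE; split=> [->|E]; [rewrite K' | rewrite -{2}E K].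
Qed.

End Isomorphism.

Section TotalSubgroup.
Local Open Scope group_scope.
Local Open Scope order_scope.

Record total_subgroup d (L : lpregroupType d) := TotalSubgroup {
  tsub_mem :> {pred L};
  tsub1 : 1 \in tsub_mem;
  tsubM : {in tsub_mem &, forall x y, x * y \in tsub_mem};
  tsubV : {in tsub_mem, forall x, ladj x \in tsub_mem};
  tsub_invertible : {in tsub_mem, forall x, invertible x};
  tsub_total : {in tsub_mem &, forall x y, (x <= y) || (y <= x)}
}.

Context d (L : lpregroupType d) (S : total_subgroup L).

Record tsub_type : predArgType :=
  TSub { tsub_val : L; _ : tsub_val \in tsub_mem S }.

HB.instance Definition _ := [isSub for tsub_val].
HB.instance Definition _ := [Choice of tsub_type by <:].

Fact tsub_meet_closed : meet_closed (tsub_mem S).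
Proof.
move=> x y xS yS; have /orP[/meet_idPl ->//|] := tsub_total xS yS.
by rewrite meetC => /meet_idPl ->.
Qed.

Fact tsub_join_closed : join_closed (tsub_mem S).
Proof.
move=> x y xS yS; have /orP[/join_idPr|/join_idPl] := tsub_total xS yS.
  by move->.
by move->.
Qed.

Fact tsub_umagma_closed : umagma_closed (tsub_mem S).
Proof. by split=> [|x y]; [exact: tsub1 | exact: tsubM]. Qed.

HB.instance Definition _ := Order.SubChoice_isSubLattice.Build d L
  (tsub_mem S) d tsub_type tsub_meet_closed tsub_join_closed.
HB.instance Definition _ := SubChoice_isSubMonoid.Build L
  (tsub_mem S) tsub_type tsub_umagma_closed.

Lemma tsub_leE (x y : tsub_type) : (x <= y) = (val x <= val y).
Proof. by rewrite -Order.le_val. Qed.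

Fact tsub_le_total : total (<=%O : rel tsub_type).
Proof. by move=> x y; rewrite !tsub_leE;
  exact: (tsub_total (valP x) (valP y)). Qed.

HB.instance Definition _ := Order.Lattice_isTotal.Build d tsub_type
  tsub_le_total.

Definition tsub_inv (x : tsub_type) : tsub_type := TSub (tsubV (valP x)).

Fact tsub_mulV x : tsub_inv x * x = 1.
Proof. by apply: val_inj; rewrite valM val1;
  exact/invertibleVg/tsub_invertible/valP. Qed.

Fact tsub_divV x : x * tsub_inv x = 1.
Proof. by apply: val_inj; rewrite valM val1;
  exact/invertiblegV/tsub_invertible/valP. Qed.

Fact tsub_lemul2r (z x y : tsub_type) : x <= y -> x * z <= y * z.
Proof. by rewrite !tsub_leE !valM; exact: lemul2r. Qed.

Fact tsub_lemul2l (z x y : tsub_type) : x <= y -> z * x <= z * y.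
Proof. by rewrite !tsub_leE !valM; exact: lemul2l. Qed.

Fact tsub_mulV_le x : tsub_inv x * x <= (1 : tsub_type).
Proof. by rewrite tsub_mulV. Qed.

Fact tsub_mulV_ge x : (1 : tsub_type) <= tsub_inv x * x.
Proof. by rewrite tsub_mulV. Qed.

Fact tsub_divV_le x : x * tsub_inv x <= (1 : tsub_type).
Proof. by rewrite tsub_divV. Qed.

Fact tsub_divV_ge x : (1 : tsub_type) <= x * tsub_inv x.
Proof. by rewrite tsub_divV. Qed.

HB.instance Definition _ := isLPregroup.Build d tsub_type
  tsub_lemul2r tsub_lemul2l tsub_mulV_le tsub_divV_ge tsub_divV_le tsub_mulV_ge.
HB.instance Definition _ := LPregroup_isLGroup.Build d tsub_type (fun=> erefl).

End TotalSubgroup.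

Section PeriodicMaps.
Local Open Scope group_scope.
Local Open Scope order_scope.

(** In F(Z) the double adjoint is conjugation by the translation by one. *)
Lemma FZ_dadjn (F : FZ) i x : dadjn i F x = (F (x - i%:Z) + i%:Z)%R.
Proof.
have dadjE (f : FZ) y : dadj f y = (f (y - 1) + 1)%R.
  have H p : (dadj f y <= p)%R = (f (y - 1)%R < p)%R.
    have h1 := FZ_ladj_adj (FZ_ladj f) y p.
    have h2 := FZ_ladj_adj f p (y - 1)%R.
    rewrite [LHS]h1 ltNge -h2 /=; lia.
  have := H (dadj f y); have := H (f (y - 1) + 1)%R; lia.
elim: i x => [|i IHi] x; first by rewrite /= subr0 addr0.
rewrite dadjnS dadjE IHi.
have -> : (x - 1 - i%:Z = x - i.+1%:Z)%R by lia.
lia.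
Qed.

Lemma FkZ_mem k (F : FZ) : (0 < k)%N ->
  (F \in periodic_mem FZ k) <-> forall x, F (x + k%:Z)%R = (F x + k%:Z)%R.
Proof.
move=> k0; split=> [/eqP/iter_adjP Fk x|Fk].
  by rewrite -{1}Fk FZ_dadjn addrK.
apply/eqP/iter_adjP/val_inj/funext => x /=.
by rewrite [LHS]FZ_dadjn -Fk subrK.
Qed.

Lemma FkZ_addM k (phi : int -> int) q x :
  (forall y, phi (y + k%:Z)%R = (phi y + k%:Z)%R) ->
  phi (x + k%:Z * q)%R = (phi x + k%:Z * q)%R.
Proof.
move=> per; have pos (m : nat) y : phi (y + k%:Z * m%:Z)%R = (phi y + k%:Z *
  m%:Z)%R.
  elim: m => [|m IHm]; first by rewrite mulr0 !addr0.
  by rewrite intS mulrDr mulr1 [(k%:Z + _)%R]addrC addrA per IHm addrA.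
case: q => m; first exact: pos.
rewrite NegzE mulrN; have := pos m.+1 (x - k%:Z * m.+1%:Z)%R.
by rewrite subrK => ->; rewrite addrK.
Qed.

Lemma FZ_mem_periodic k (phi : int -> int) : (0 < k)%N ->
  {homo phi : x y / (x <= y)%R} -> (forall x, phi (x + k%:Z)%R = (phi x +
    k%:Z)%R) ->
  phi \in FZ_mem.
Proof.
move=> k0 mono per; apply/asboolP; split=> // x.
have [q qE] : exists q : nat, q = `|(x - phi 0)%R|%N.+1 by eexists.
have [K KE] : exists K : int, K = (k%:Z * q%:Z)%R by eexists.
have qK : (q%:Z <= K)%R by rewrite KE -PoszM lez_nat leq_pmull.
have h1 : phi K = (phi 0 + K)%R.
  by rewrite -{1}[K]add0r KE; exact: FkZ_addM.
have h2 : phi 0%R = (phi (- K) + K)%R.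
  by rewrite -{1}(addNr K) KE; exact: FkZ_addM.
apply: sub_finite_set (finite_set_itvoc (- K - 1) K)%R => y /= yx.
have m1 : ~~ (K < y)%R by apply/negP => /ltW/mono; rewrite yx; lia.
have m2 : ~~ (y <= - K - 1)%R.
  apply/negP => yK.
  have /mono : (y <= - K)%R by lia.
  rewrite yx; lia.
lia.
Qed.

End PeriodicMaps.

(** * The group skeleton as an additive group *)

Section SkeletonZmodule.
Local Open Scope group_scope.
Local Open Scope order_scope.
Context d (L : lpregroupType d) (ab : commutative (@mul (group_skeleton L))).

(** The proof of commutativity is a parameter of the type because the instance of
    additive group depends on it. *)
Definition skel_zmod_of (_ : commutative (@mul (group_skeleton L))) : Type :=
  group_skeleton L.
Local Notation skel_zmod := (skel_zmod_of ab).

HB.instance Definition _ := Choice.copy skel_zmod (group_skeleton L).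

Definition skel_add (x y : skel_zmod) : skel_zmod := (x : group_skeleton L) * y.
Definition skel_opp (x : skel_zmod) : skel_zmod := ladj (x : group_skeleton L).
Definition skel_zero : skel_zmod := (1 : group_skeleton L).

Fact skel_addA : associative skel_add. Proof. exact: mulgA. Qed.
Fact skel_addC : commutative skel_add. Proof. exact: ab. Qed.
Fact skel_add0 : left_id skel_zero skel_add. Proof. exact: mul1g. Qed.
Fact skel_addN : left_inverse skel_zero skel_opp skel_add.
Proof. by move=> x; apply/invertibleVg/ladj_radj. Qed.

HB.instance Definition _ :=
  GRing.isZmodule.Build skel_zmod skel_addA skel_addC skel_add0 skel_addN.

Definition skel_val (z : skel_zmod) : L := periodic_val z.
Implicit Types (x y : L) (u z w : skel_zmod).

Lemma skel_inj : injective skel_val. Proof. exact: val_inj. Qed.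
Lemma skel_val0 : skel_val 0%R = 1. Proof. exact: val1. Qed.
Lemma skel_valD z w : skel_val (z + w)%R = skel_val z * skel_val w. Proof.
  exact: valM. Qed.
Lemma skel_valN z : skel_val (- z)%R = ladj (skel_val z). Proof. by []. Qed.

Lemma skel_invertible z : invertible (skel_val z).
Proof. by have /eqP := valP (z : group_skeleton L). Qed.

Definition skel_of x (xE : invertible x) : skel_zmod :=
  PeriodicSub (introT eqP xE : x \in periodic_mem L 1).

Lemma skel_surj x : invertible x -> exists z, skel_val z = x.
Proof. by move=> xE; exists (skel_of xE). Qed.

Lemma skel_comm x y : invertible x -> invertible y -> x * y = y * x.
Proof.
by move=> /skel_surj[z <-] /skel_surj[w <-]; rewrite -!skel_valD addrC.
Qed.

Lemma skel_valMn z m : skel_val (z *+ m)%R = skel_val z ^+ m.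
Proof.
elim: m => [|m IHm]; first by rewrite mulr0n skel_val0.
by rewrite mulrS skel_valD IHm expgS.
Qed.

Lemma skel_leD u z w : (skel_val (z + u)%R <= skel_val (w + u)%R) = (skel_val z
  <= skel_val w).
Proof. by rewrite !skel_valD invertible_leMr //; exact: skel_invertible. Qed.

Lemma skel_leN z w : (skel_val (- z)%R <= skel_val (- w)%R) = (skel_val w <=
  skel_val z).
Proof.
apply/idP/idP => [/le_radj|]; last exact: le_ladj.
by rewrite !skel_valN !ladjK.
Qed.

End SkeletonZmodule.

(** * The least positive invertible element *)

Section Orbital.
Local Open Scope group_scope.
Local Open Scope order_scope.
Context (n : nat) (n_gt0 : (0 < n)%N) d (L : lpregroupType d).
Hypothesis Lper : forall x : L, dadjn n x = x.
Context (k : nat) (a : L).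
Hypothesis k_gt1 : (1 < k)%N.
Hypothesis a_orbital : orbital k a.
Implicit Types x y g h : L.

Local Notation ceil := (ceil n).
Let t := ceil a.

Let a_gt1 : 1 < a. Proof. by case: a_orbital. Qed.
Let k_gt0 : (0 < k)%N. Proof. exact: ltnW. Qed.

Lemma orbit_ge1 i : 1 <= dadjn i a.
Proof. by rewrite dadjn_ge1 ltW. Qed.

Lemma orbit_mod i : dadjn (i %% k) a = dadjn i a.
Proof.
have [_ _ ak _] := a_orbital.
rewrite [in RHS](divn_eq i k) addnC dadjnD; congr dadjn.
by elim: (_ %/ _) => // q IHq; rewrite mulSn addnC dadjnD ak.
Qed.

Lemma orbit_eqmod i j : i = j %[mod k] -> dadjn i a = dadjn j a.
Proof. by move=> ij; rewrite -orbit_mod ij orbit_mod. Qed.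

Lemma orbit_orth i j : i != j %[mod k] -> dadjn i a `&` dadjn j a <= 1.
Proof.
have [_ _ _ aorth] := a_orbital.
wlog ij : i j / (i <= j)%N => [H|].
  case/orP: (leq_total i j) => /H //; rewrite eq_sym meetC; exact.
rewrite eq_sym eqn_mod_dvd // => /aorth; rewrite -(le_dadjn i) dadjn1 dadjnI.
by rewrite -dadjnD subnKC.
Qed.

Lemma orbit_mul_le i j : j != i %[mod k] ->
  dadjn j.+1 a * dadjn i a <= dadjn j.+1 a `|` dadjn i a.
Proof. by move/orbit_orth; exact: dadj_mul_orth. Qed.

(** The preceding orbit element is different from this one since [1 < k], so that
    the orthogonality of the two applies to the square. *)
Lemma orbit_closure i : dadjn i a * dadjn i a <= dadjn i a.
Proof.
have E : dadjn (i + k.-1).+1 a = dadjn i a.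
  by apply: orbit_eqmod; rewrite -addnS prednK // modnDr.
have := @orbit_mul_le i (i + k.-1); rewrite E joinxx; apply.
rewrite -[X in _ == X %[mod _]]addn0 eqn_modDl mod0n modn_small ?prednK //.
by rewrite -lt0n -ltnS prednK.
Qed.

Lemma t_invertible : invertible t. Proof. exact: ceil_invertible. Qed.

Lemma t_lub : is_lub (fun i => dadjn i a) t. Proof. exact: ceil_lub. Qed.

Lemma orbit_le_t i : dadjn i a <= t. Proof. exact: ceil_dadjn_ge. Qed.

Lemma t_gt1 : 1 < t. Proof. exact: lt_le_trans (orbit_le_t 0). Qed.

(** In the product [dadjn j a * dadjn i a] only [j = i + 1] gives more than a
    join, so both sides are the join of [t] and [dadjn i.+1 a * dadjn i a]. *)
Lemma t_orbit i : t * dadjn i a = dadjn i.+1 a * t.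
Proof.
apply: le_anti; apply/andP; split.
  rewrite mul_le_ladj; apply/t_lub => j; rewrite -mul_le_ladj.
  have [ji|ji] := boolP (j == i.+1 %[mod k]).
    by rewrite (orbit_eqmod (eqP ji)) lemul2l // orbit_le_t.
  apply: le_trans (_ : t <= _); last first.
    by rewrite -{1}[t]mul1g lemul2r // orbit_ge1.
  have jE : dadjn j a = dadjn (j + k.-1).+1 a.
    by apply: orbit_eqmod; rewrite -addnS prednK // modnDr.
  rewrite jE; apply: le_trans (orbit_mul_le _) _;
    last by rewrite leUx !orbit_le_t.
  apply: contra ji => /eqP ji.
  have : (j + k.-1).+1 = i.+1 %[mod k] by rewrite -addn1 -modnDml ji modnDml
    addn1.
  by rewrite -addnS prednK // modnDr => ->.
rewrite mul_le_radj; apply/t_lub => j; rewrite -mul_le_radj.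
have [ji|ji] := boolP (i == j %[mod k]).
  by rewrite -(orbit_eqmod (eqP ji)) lemul2r // orbit_le_t.
apply: le_trans (orbit_mul_le ji) _.
apply: le_trans (_ : t <= _); first by rewrite leUx !orbit_le_t.
by rewrite -{1}[t]mulg1 lemul2l // orbit_ge1.
Qed.

Lemma tX_orbit m i : t ^+ m * dadjn i a = dadjn (m + i) a * t ^+ m.
Proof.
elim: m i => [|m IHm] i; first by rewrite expg0 mul1g mulg1.
by rewrite expgSr -mulgA t_orbit mulgA IHm -mulgA -expgSr addnS.
Qed.

(** ** The group of invertible elements permutes the orbit *)

Hypothesis Gtotal : forall g h, invertible g -> invertible h ->
  (g <= h) || (h <= g).
Hypothesis ab : commutative (@mul (group_skeleton L)).

Let Gcomm := @skel_comm _ _ ab.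

Lemma invertible_leNgt g h : invertible g -> invertible h ->
  ~~ (g <= h) -> h < g.
Proof.
move=> gE hE gh; have := Gtotal gE hE; rewrite (negbTE gh) /= => hg.
by rewrite lt_neqAle hg andbT; apply: contraNneq gh => ->.
Qed.

Lemma invertible_max (rho : nat -> L) m : (forall i, invertible (rho i)) ->
  exists i, forall j, (j <= m)%N -> rho j <= rho i.
Proof.
move=> rhoE; elim: m => [|m [i IHm]].
  by exists 0%N => j; rewrite leqn0 => /eqP ->.
have /orP[le|le] := Gtotal (rhoE m.+1) (rhoE i).
  by exists i => j; rewrite leq_eqVlt => /predU1P[->|/IHm].
exists m.+1 => j; rewrite leq_eqVlt => /predU1P[->|/IHm h] //;
  exact: le_trans le.
Qed.

Lemma le_from_orbit x y : x <= t -> (forall i, x `&` dadjn i a <= y) -> x <= y.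
Proof. by move=> /meet_idPl {2}<- xy;
  exact: meet_lub_le t_invertible t_lub xy. Qed.

(** With [e] the conjugate of [a] by [w], the elements [a `&` dadjn j e] join to
    [a]. Totality singles out one [j] for which the ceiling of this meet is
    already [t], and orthogonality then forces [dadjn j e] to be [a]. *)
Lemma invertible_permutes_orbit (w : L) : invertible w ->
  exists j, forall i, w * dadjn i a = dadjn (i + j) a * w.
Proof.
move=> wE; have wVE := invertibleV wE; pose e := w * a * ladj w.
have eorb i : dadjn i e = w * dadjn i a * ladj w.
  by rewrite /e !dadjnM (dadjn_invertible i wE) (dadjn_invertible i wVE).
have emod i : dadjn (i %% k) e = dadjn i e by rewrite !eorb orbit_mod.
have conj_le x y : (w * x * ladj w <= y) = (x <= ladj w * y * w).
  by rewrite mul_le_ladj -[ladj (ladj w)]/(dadj w) dadj_invertible //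
    mul_le_radj -wE mulgA.
have conj_fix g : invertible g -> ladj w * g * w = g.
  by move=> gE; rewrite -mulgA (Gcomm gE wE) invertible_mulKl.
have ele i : dadjn i e <= t.
  by rewrite eorb conj_le conj_fix ?orbit_le_t //; exact: t_invertible.
have aceil : a <= ceil e.
  by rewrite -(conj_fix _ (ceil_invertible n_gt0 Lper e)) -conj_le (ceil_ge
    n_gt0 Lper e).
have e_ge1 : 1 <= e by rewrite /e -mulgA -(invertiblegV wE) lemul2l // -{1}[ladj
  w]mul1g lemul2r // ltW.
pose r j := a `&` dadjn j e; pose rho j := ceil (r j).
have [//|j0 j0max] := @invertible_max rho n.
  by move=> i; exact: ceil_invertible.
have a_le : a <= ceil (r j0).
  rewrite -[a](meet_idPl aceil).
  apply: meet_lub_le (ceil_invertible n_gt0 Lper e) (ceil_lub n_gt0 Lper e) _ =>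
    j.
  rewrite -(dadjn_mod Lper); apply: le_trans (j0max (j %% n) _).
    exact: (ceil_ge n_gt0 Lper).
  by rewrite ltnW // ltn_pmod.
pose f := dadjn j0 e.
have f_ge1 : 1 <= f by rewrite dadjn_ge1.
have af : a <= f.
  rewrite -[a](meet_idPl a_le).
  apply: meet_lub_le (ceil_invertible n_gt0 Lper _) (ceil_lub n_gt0 Lper _) _ =>
    i.
  have [/eqP i0|i0] := boolP (i == 0 %[mod k]).
    rewrite dadjnI -dadjnD -emod -modnDml i0 modnDml emod add0n.
    by rewrite (le_trans (leIr _ _)) // leIr.
  apply: le_trans (f_ge1); apply: le_trans (_ : a `&` dadjn i a <= _).
    by rewrite dadjnI meetA leIl.
  by rewrite meetC; exact: (@orbit_orth i 0).
have fa : f <= a.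
  apply: le_from_orbit => [|i]; first exact: ele.
  have [/eqP i0|i0] := boolP (i == 0 %[mod k]);
    first by rewrite (orbit_eqmod i0) leIr.
  apply: le_trans (ltW a_gt1); apply: le_trans (_ : f `&` dadjn i f <= _).
    by rewrite leI2 ?le_dadjn.
  rewrite /f -dadjnD !eorb -mulgIl -mulgIr conj_le mulg1 invertibleVg //.
  by apply: orbit_orth; rewrite -{1}[j0]add0n eqn_modDr eq_sym.
have wj0 : w * dadjn j0 a = a * w.
  have : f = a by apply: le_anti; rewrite fa af.
  by rewrite /f eorb => fE; rewrite -{2}fE -mulgA invertibleVg // mulg1.
exists (j0 * k.-1)%N => i; set m := (i + _)%N.
have -> : dadjn i a = dadjn (m + j0) a.
  by apply: orbit_eqmod; rewrite -addnA -mulnSr prednK // addnC modnMDl.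
by rewrite dadjnD -{1}(dadjn_invertible m wE) -dadjnM wj0 dadjnM
  (dadjn_invertible m wE).
Qed.

(** The bound is a product: by [orthM] it remains orthogonal to [dadjn m a]. *)
Lemma orth_bound m : exists b, [/\ 1 <= b, dadjn m a `&` b <= 1 &
  forall j, j != m %[mod k] -> dadjn j a <= b].
Proof.
suff H p : exists b, [/\ 1 <= b, dadjn m a `&` b <= 1 &
    forall j, (j < p)%N -> j != m %[mod k] -> dadjn j a <= b].
  have [b [b1 mb jb]] := H k; exists b; split=> // j jm;
    rewrite -orbit_mod jb ?ltn_pmod //.
  by rewrite modn_mod.
elim: p => [|p [b [b1 mb jb]]].
  by exists 1; split=> //; exact: leIr.
have [pm|pm] := boolP (p == m %[mod k]).
  exists b; split=> // j; rewrite ltnS leq_eqVlt => /predU1P[->|/jb //].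
  by rewrite pm.
exists (dadjn p a * b); split.
- by rewrite -[leLHS]mul1g lemul2 // orbit_ge1.
- by apply: orthM; rewrite ?orbit_ge1 //; apply: orbit_orth; rewrite eq_sym.
- move=> j; rewrite ltnS leq_eqVlt => /predU1P[-> _|/jb jb' /jb' jle].
    by rewrite -{1}[dadjn p a]mulg1 lemul2l.
  by apply: le_trans jle _; rewrite -{1}[b]mul1g lemul2r // orbit_ge1.
Qed.

(** Let [m := j - 1] modulo [k]. Then [w * a] is fixed by the closure [dadjn m.+1 a],
    so it lies below [ladj (dadjn m a) * t * a]. If [m] is not zero modulo [k],
    the latter is bounded by orbit elements orthogonal to [dadjn m a], hence so
    is [w]; by conjugation [w] is orthogonal to the whole orbit, and [w <= t]. *)
Lemma permute_not1 (w : L) j : invertible w -> 1 <= w -> w <= t ->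
  w * a = dadjn j a * w -> j != 1 %[mod k] -> w = 1.
Proof.
move=> wE w1 wt wa j1; pose m := (j + k.-1)%N.
have mS : dadjn m.+1 a = dadjn j a.
  by apply: orbit_eqmod; rewrite -addnS prednK // modnDr.
have m0 : m != 0 %[mod k].
  apply: contra j1 => /eqP m0.
  by rewrite -(modnDr j k) -[X in (j + X)%N](prednK k_gt0) addnS -addn1 -modnDml
    m0 modnDml.
have [b [b_ge1 mb jb]] := orth_bound m.
have wm : w `&` dadjn m a <= 1.
  apply: le_trans (_ : b * b `&` dadjn m a <= _); last first.
    by rewrite meetC; exact: (orthM (orbit_ge1 m) b_ge1 b_ge1 mb mb).
  apply: leI2 => //; apply: le_trans (_ : ladj (dadjn m a) * (t * a) <= _).
    apply: le_trans (_ : w * a <= _);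
      first by rewrite -{1}[w]mulg1 lemul2l // ltW.
    apply: le_trans (_ : ladj (dadjn m a) * (w * a) <= _);
      last by rewrite lemul2l // lemul2r.
    by rewrite le_mul_ladj -[ladj _]/(dadj _) -dadjnS mS wa mulgA lemul2r //
      orbit_closure.
  rewrite mulgA mul_le_ladj mul_le_radj; apply/t_lub => i.
  rewrite -mul_le_radj -mul_le_ladj.
  apply: lemul2; last by apply: (jb 0%N); rewrite eq_sym.
  have [/eqP im|im] := boolP (i == m %[mod k]).
    by rewrite (orbit_eqmod im) (le_trans (ladj_mul_le1 _)).
  rewrite -[b]mul1g lemul2 ?jb // -ladj1 le_ladj //; exact: orbit_ge1.
apply: le_anti; rewrite w1 andbT; apply: le_from_orbit => // i.
have [q iq] : exists q, i = (m + q) %[mod k].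
  exists (i + m * k.-1)%N.
  by rewrite addnCA -mulnS prednK // addnC modnMDl.
rewrite (orbit_eqmod iq) addnC dadjnD -(dadjn_invertible q wE) -dadjnI.
by rewrite -(dadjn1 L q) le_dadjn.
Qed.

(** An invertible [w] strictly between 1 and [t] would shift the orbit by one, like
    [t]; then [ladj w * t] is again between 1 and [t] but does not move the orbit,
    so it is 1. *)
Lemma t_least (w : L) : invertible w -> 1 < w -> t <= w.
Proof.
move=> wE w1; have tE := t_invertible.
apply/negPn/negP => /(invertible_leNgt tE wE) wt.
have [j wj] := invertible_permutes_orbit wE.
have wa : w * a = dadjn j a * w by exact: (wj 0%N).
have [/eqP j1|/(permute_not1 wE (ltW w1) (ltW wt) wa) wE1] := boolP (j == 1
  %[mod k]);
  last by rewrite wE1 ltxx in w1.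
pose v := ladj w * t; have vE : invertible v by
  apply/invertibleM/tE/invertibleV.
have v1 : v = 1.
  apply: (@permute_not1 v 0) => //.
  - by rewrite /v le_mul_ladj -[ladj _]/(dadj w) dadj_invertible // mulg1 ltW.
  - by rewrite -[leRHS]mul1g lemul2r // -ladj1 le_ladj // ltW.
  - rewrite /v -mulgA -[t * a]/(t * dadjn 0 a) t_orbit !mulgA; congr (_ * _).
    rewrite -{1}(@orbit_eqmod j 1 j1) -[LHS]mulg1 -(invertiblegV wE).
    by rewrite -mulgA [dadjn j a * _]mulgA -wa !mulgA invertibleVg // mul1g.
  - by rewrite mod0n modn_small.
move: wt; rewrite -[t](invertible_mulVKl wE) -/v v1 mulg1 ltxx //.
Qed.


(** ** The orbit elements are atoms when the period is maximal *)

Hypothesis k_max : forall k' (z : L), orbital k' z -> (k' <= k)%N.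

(** An orbital element [z <= y] has a period divisible by [k], hence equal to [k]
    by maximality. Its ceiling is at least [t], so [a] is the join of its meets
    with the conjugates of [z]; all of these but [z] are orthogonal to [a]. *)
Lemma orbit_atom y : 1 < y -> y <= a -> a <= y.
Proof.
move=> y1 ya; have [z [k' [zy zorb]]] := exists_orbital n_gt0 Lper y1.
have [z1 k'0 zk' zorth] := zorb; have [_ _ _ aorth] := a_orbital.
have kk' : (k %| k')%N.
  apply/negPn/negP => /aorth; apply/negP; rewrite lt_geF // (lt_le_trans z1) //.
  by rewrite lexI -{2}zk' le_dadjn (le_trans zy).
have {k' kk' k'0 zorb zk' zorth} zk : dadjn k z = z.
  have /eqP <- : k' == k by rewrite eqn_leq (k_max zorb) dvdn_leq.
  by [].
apply: (le_trans _ zy); have zE := ceil_invertible n_gt0 Lper z.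
have /meet_idPl <- : a <= ceil z.
  apply: le_trans (orbit_le_t 0) (t_least zE _).
  exact/(lt_le_trans z1)/ceil_ge.
apply: meet_lub_le zE (ceil_lub n_gt0 Lper z) _ => i.
have [/dvdnP[q ->]|/aorth] := boolP (k %| i)%N.
  suff -> : dadjn (q * k) z = z by exact: leIr.
  by elim: q => // q IHq; rewrite mulSn addnC dadjnD zk.
move=> h; apply: le_trans (ltW z1); apply: le_trans h.
by rewrite leI2 // le_dadjn (le_trans zy).
Qed.

Lemma orbit_dichotomy y i : 1 <= y -> dadjn i a <= y \/ y `&` dadjn i a <= 1.
Proof.
move=> y1; pose j := (i * n.-1)%N.
have ij x : dadjn j (dadjn i x) = x.
  by rewrite -dadjnD addnC -mulnS prednK // -(dadjn_mod Lper) modnMl.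
have [le1|gt1] := boolP (y `&` dadjn i a <= 1); [by right|left].
rewrite -(le_dadjn j) ij.
apply: le_trans (_ : dadjn j (y `&` dadjn i a) <= _);
  last by rewrite le_dadjn leIl.
apply: orbit_atom; last by rewrite dadjnI ij leIr.
rewrite lt_neqAle dadjn_ge1 lexI y1 orbit_ge1 !andbT;
  apply: contra gt1 => /eqP E.
by rewrite -(le_dadjn j) -E dadjn1.
Qed.

(** ** A maximal closure *)

Fixpoint orbit_prod m := if m is p.+1 then dadjn p.+1 a * orbit_prod p else 1.

(** In F_k(Z) this is the closure operator whose fixed points are the multiples
    of [k]: it moves every other point step by step up to the next one. *)
Definition max_closure := orbit_prod k.-1.
Local Notation A := max_closure.

Lemma orbit_prodS m : orbit_prod m.+1 = dadjn m.+1 a * orbit_prod m.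
Proof. by []. Qed.

Lemma orbit_prod_ge1 m : 1 <= orbit_prod m.
Proof.
by elim: m => //= m IHm; rewrite -[leLHS]mul1g lemul2 // (orbit_ge1 m.+1).
Qed.

(** A factor [dadjn j a] that is not the successor of the next factor can be
    joined to it instead of being multiplied, and is absorbed further right. *)
Lemma orbit_prod_absorb m j : (0 < j <= m)%N -> (m < k)%N ->
  dadjn j a * orbit_prod m = orbit_prod m.
Proof.
elim: m j => [|m IHm] j /andP[j0 jm] mk; first by move: j0; rewrite ltnNge jm.
apply: le_anti; apply/andP; split; last by rewrite -{1}[orbit_prod _]mul1g
  lemul2r // orbit_ge1.
move: jm; rewrite leq_eqVlt => /predU1P[->|jm].
  by rewrite orbit_prodS mulgA lemul2r // (orbit_closure m.+1).
have jP : dadjn j a * orbit_prod m = orbit_prod m by apply: IHm;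
  rewrite ?j0 // ltnW.
have j1k : (j.-1 < k)%N by lia.
have jm1 : j.-1 != m.+1 %[mod k] by rewrite (modn_small j1k) (modn_small mk);
  lia.
rewrite orbit_prodS mulgA -[j]prednK //.
apply: le_trans (lemul2r _ (orbit_mul_le jm1)) _.
rewrite prednK // mulgUl jP leUx lexx andbT.
by rewrite -{1}[orbit_prod m]mul1g lemul2r // (orbit_ge1 m.+1).
Qed.

Lemma max_closure_ge1 : 1 <= A. Proof. exact: orbit_prod_ge1. Qed.

Lemma max_closure_le_tX : A <= t ^+ k.-1.
Proof.
rewrite /max_closure; elim: k.-1 => // m IHm.
by rewrite expgS lemul2 // (orbit_le_t m.+1).
Qed.

Lemma orbit_max_closure j : j != 0 %[mod k] -> dadjn j a * A = A.
Proof.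
rewrite mod0n => j0; rewrite -orbit_mod; apply: orbit_prod_absorb.
  by have := ltn_pmod j k_gt0; lia.
by rewrite prednK.
Qed.

Lemma max_closure_mul_le : A * A <= A.
Proof.
suff H m : (m < k)%N -> orbit_prod m * A = A by rewrite H ?prednK.
elim: m => [|m IHm] mk; first by rewrite mul1g.
rewrite orbit_prodS -mulgA IHm ?(ltnW mk) // (@orbit_max_closure m.+1) //.
by rewrite mod0n modn_small.
Qed.

Lemma t_max_closure : t * A = a * A.
Proof.
apply: le_anti; rewrite (lemul2r _ (orbit_le_t 0)) andbT.
rewrite mul_le_ladj; apply/t_lub => j; rewrite -mul_le_ladj.
have [/eqP j0|j0] := boolP (j == 0 %[mod k]); first by rewrite (orbit_eqmod j0).
by rewrite orbit_max_closure // -{1}[A]mul1g lemul2r // ltW.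
Qed.

(** Each factor of the left-hand closure moves the point reached so far by one
    step, from 1 up to [k]. *)
Lemma max_closure_t : A * t * A = t ^+ k * A.
Proof.
suff H m : (m < k)%N -> orbit_prod m * t * A = t ^+ m.+1 * A.
  by rewrite H prednK.
elim: m => [|m IHm] mk; first by rewrite mul1g expg1.
have ta := tX_orbit m.+1 0; rewrite addn0 in ta.
transitivity (dadjn m.+1 a * (orbit_prod m * t * A)); first by rewrite !mulgA.
by rewrite IHm ?(ltnW mk) // mulgA -ta -mulgA -[a * A]t_max_closure mulgA
  -expgSr.
Qed.

Lemma tX_max_closure m : t ^+ m * A = dadjn m A * t ^+ m.
Proof.
rewrite /max_closure; elim: k.-1 => [|p IHp] /=;
  first by rewrite dadjn1 mulg1 mul1g.
by rewrite dadjnM mulgA (tX_orbit m p.+1) -mulgA IHp mulgA dadjnD.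
Qed.

Lemma max_closure_comm h : invertible h -> h * a = a * h -> h * A = A * h.
Proof.
move=> hE ha; have hai i : h * dadjn i a = dadjn i a * h.
  by rewrite -[h in LHS](dadjn_invertible i hE) -dadjnM ha dadjnM
    (dadjn_invertible i hE).
rewrite /max_closure; elim: k.-1 => [|p IHp] /=; first by rewrite mulg1 mul1g.
by rewrite mulgA (hai p.+1) -!mulgA IHp.
Qed.

Lemma max_closure_leMr g h : invertible g -> invertible h ->
  (g * A <= h * A) = (g <= h).
Proof. by move=> gE hE; rewrite (closure_leMr n_gt0 Lper max_closure_ge1
  max_closure_mul_le). Qed.

Lemma max_closure_injMr g h : invertible g -> invertible h -> g * A = h * A ->
  g = h.
Proof. by move=> gE hE gh; apply: le_anti;
  rewrite -(max_closure_leMr gE hE) -(max_closure_leMr hE gE) gh lexx. Qed.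

(** The conjugates of the closure by powers of [t] meet in the unit, because an
    element below all of them has its ceiling below the closure. *)
Lemma max_closure_faithful x y : (forall m, x * t ^+ m * A <= y * t ^+ m * A) ->
  x <= y.
Proof.
move=> xy; have H m : ladj y * x <= dadjn m A.
  rewrite -le_mul_ladj; apply: le_trans (_ : x * dadjn m A <= _).
    by rewrite -{1}[x]mulg1 lemul2l // dadjn_ge1 max_closure_ge1.
  rewrite -(invertible_leMr _ _ (invertibleX m t_invertible)) -!mulgA
    -tX_max_closure.
  by rewrite !mulgA.
suff : ladj y * x <= 1 by rewrite -le_mul_ladj mulg1.
apply: le_trans (ceil_ge n_gt0 Lper _) _.
apply: (closure_invertible_le1 n_gt0 Lper max_closure_mul_le (ceil_invertible
  n_gt0 Lper _)).
apply/(ceil_lub n_gt0 Lper) => i.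
rewrite -(le_dadjn (i * n.-1)) -dadjnD addnC -mulnS prednK //.
by rewrite -(dadjn_mod Lper) modnMl /= H.
Qed.

Lemma tX_le i j : (t ^+ i <= t ^+ j) = (i <= j)%N.
Proof.
have tX m : 1 <= t ^+ m.
  by elim: m => // m IHm; rewrite expgS -[leLHS]mul1g lemul2 // ltW // t_gt1.
have le_tX p q : (p <= q)%N -> t ^+ p <= t ^+ q.
  by move=> /subnKC <-; rewrite expgnDr -{1}[t ^+ p]mulg1 lemul2l.
apply/idP/idP => [|/le_tX //]; case: leqP => // /le_tX ji ij.
have := le_trans ji ij; rewrite expgS -{2}[t ^+ j]mul1g.
by rewrite invertible_leMr ?(lt_geF t_gt1) //; exact/invertibleX/t_invertible.
Qed.

(** Here [t ^+ m.+1] is the join of the [dadjn i a * t ^+ m]. The factors with [i]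
    divisible by [k] disappear in the meet with [y], the others are absorbed. *)
Lemma orth_meet_tX y m : 1 <= y -> y `&` a <= 1 -> y `&` t ^+ m <= A.
Proof.
move=> y1 ya; elim: m => [|m IHm]; first by rewrite (le_trans (leIr _ _)) //
  max_closure_ge1.
have tmE := invertibleX m t_invertible.
have tm1 : 1 <= t ^+ m by rewrite -(expg0 t) tX_le.
have lub : is_lub (fun i => dadjn i a * t ^+ m) (t ^+ m.+1).
  move=> z; rewrite expgS mul_le_ladj; split=> [/t_lub h i|h].
    by rewrite mul_le_ladj.
  by apply/t_lub => i; rewrite -mul_le_ladj.
apply: meet_lub_le (invertibleX m.+1 t_invertible) lub _ => i.
apply: le_trans (meet_mul_le y1 (orbit_ge1 i) tm1) _.
have [/eqP i0|i0] := boolP (i == 0 %[mod k]).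
  by rewrite -[A]mul1g lemul2 // (orbit_eqmod i0).
by rewrite -(orbit_max_closure i0) lemul2 // leIr.
Qed.

(** The powers of [t] cannot all lie below [ceil y], since [t ^+ k] would then
    be a join of elements below the conjugates of the closure, all of which are
    at most [t ^+ k.-1]. *)
Lemma orth_le_max_closure y : 1 <= y -> y `&` a <= 1 -> y <= A.
Proof.
move=> y1 ya; have tkE := invertibleX k t_invertible.
have yE := ceil_invertible n_gt0 Lper y.
have [ty|/(invertible_leNgt tkE yE) yt] := boolP (t ^+ k <= ceil y); last first.
  suff /meet_idPl <- : y <= t ^+ k by exact: orth_meet_tX.
  exact/(le_trans (ceil_ge n_gt0 Lper y))/ltW.
have : t ^+ k <= t ^+ k.-1; last by rewrite tX_le leqNgt prednK // leqnn.
rewrite -[leLHS](meet_idPl ty).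
apply: meet_lub_le yE (ceil_lub n_gt0 Lper y) _ => i.
rewrite -(dadjn_invertible i tkE) -dadjnI.
rewrite -(dadjn_invertible i (invertibleX k.-1 t_invertible)) le_dadjn.
by apply: le_trans max_closure_le_tX; rewrite meetC; exact: orth_meet_tX.
Qed.

(** Multiplication on the left acts on the elements [g * A] with [g] invertible:
    this is the evaluation of maps at points. With [g := floor (x * A)], the
    element [ladj g * (x * A)] is not above [t], hence orthogonal to some orbit
    element, which can only be [a] because all others lie below [A]. *)
Lemma max_closure_action x : exists2 g, invertible g & x * A = g * A.
Proof.
pose g := floor n (x * A); have gE : invertible g := floor_invertible n_gt0 Lper
  _.
have gVE := invertibleV gE.
exists g => //; pose y := ladj g * (x * A).
have yA : y * A = y.
  apply: le_anti; rewrite -{3}[y]mulg1 lemul2l ?max_closure_ge1 // andbT.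
  by rewrite /y -!mulgA !lemul2l // max_closure_mul_le.
have y1 : 1 <= y.
  by rewrite /y le_mul_ladj -[ladj _]/(dadj g) dadj_invertible // mulg1
    (floor_le n_gt0 Lper).
have Ay : A <= y by rewrite -yA -{1}[A]mul1g lemul2r.
suff yle : y <= A.
  have yE : y = A by apply: le_anti; rewrite yle Ay.
  by rewrite -{2}yE /y mulgA invertiblegV // mul1g.
have [//|ya] := orbit_dichotomy 0 y1; last exact: orth_le_max_closure.
move=> ay; suff ty : t <= y.
  have : g * t <= g.
    rewrite (le_floor n_gt0 Lper); last exact/invertibleM/t_invertible.
    by rewrite -(invertible_leMl _ _ gVE) invertible_mulKl.
  by rewrite -{2}[g]mulg1 invertible_leMl // (lt_geF t_gt1).
apply/t_lub => j; have [/eqP j0|j0] := boolP (j == 0 %[mod k]).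
  by rewrite (orbit_eqmod j0).
by apply: le_trans Ay; rewrite -(orbit_max_closure j0) -{1}[dadjn j a]mulg1
  lemul2l // max_closure_ge1.
Qed.

(** Both bounds come from [1 <= A <= t ^+ k.-1] and [x * A = g * A]. *)
Lemma near_invertible x : exists2 g, invertible g &
  x <= g * t ^+ k.-1 /\ g <= x * t ^+ k.-1.
Proof.
have [g gE xA] := max_closure_action x; exists g => //; split.
  apply: le_trans (_ : x * A <= _); first by rewrite -{1}[x]mulg1 lemul2l //
    max_closure_ge1.
  by rewrite xA lemul2l // max_closure_le_tX.
apply: le_trans (_ : g * A <= _); first by rewrite -{1}[g]mulg1 lemul2l //
  max_closure_ge1.
by rewrite -xA lemul2l // max_closure_le_tX.
Qed.

Lemma tX_convex g m : invertible g -> 1 <= g -> g <= t ^+ m -> exists j,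
  g = t ^+ j.
Proof.
have tE := t_invertible.
elim: m g => [|m IHm] g gE g1 gm.
  by exists 0%N; apply: le_anti; rewrite gm g1.
have [->|g_ne1] := eqVneq g 1; first by exists 0%N.
have tg : t <= g by apply: t_least => //; rewrite lt_neqAle eq_sym g_ne1.
have [||j jE] := IHm (ladj t * g) (invertibleM (invertibleV tE) gE).
- by rewrite le_mul_ladj -[ladj _]/(dadj t) dadj_invertible // mulg1.
- by rewrite -le_mul_ladj -expgS.
by exists j.+1; rewrite expgS -jE invertible_mulVKl.
Qed.

(** * Integer powers of [t] and the complement of the group they form *)

Local Notation V := (skel_zmod_of ab).
Local Notation sval := (@skel_val _ _ ab).

Let tV : V := skel_of ab t_invertible.

Implicit Types z w : V.

Definition zpow (j : int) : L := sval (tV *~ j)%R.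

Lemma zpow_nat m : zpow m%:Z = t ^+ m. Proof. exact: (skel_valMn tV m). Qed.
Lemma zpow0 : zpow 0 = 1. Proof. exact: (zpow_nat 0). Qed.
Lemma zpowD i j : zpow (i + j)%R = zpow i * zpow j.
Proof. by rewrite /zpow mulrzDr skel_valD. Qed.
Lemma zpow_invertible j : invertible (zpow j). Proof. exact: skel_invertible.
  Qed.

Lemma zpow_le i j : (zpow i <= zpow j) = (i <= j)%R.
Proof.
have le_zpow m p : (m <= p)%R -> zpow m <= zpow p.
  move=> mp; have -> : p = (m + `|p - m|%N%:Z)%R by lia.
  by rewrite zpowD zpow_nat -{1}[zpow m]mulg1 lemul2l // -(expg0 t) tX_le.
apply/idP/idP => [ij|/le_zpow //]; case: lerP => // ji.
have : zpow (j + 1) <= zpow j by apply: le_trans ij; apply: le_zpow; lia.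
rewrite zpowD -{2}[zpow j]mulg1 (invertible_leMl _ _ (zpow_invertible j)).
by rewrite (zpow_nat 1) expg1 (lt_geF t_gt1).
Qed.

Lemma zpow_convex (z : V) i j : zpow i <= sval z -> sval z <= zpow j ->
  exists l, z = (tV *~ l)%R.
Proof.
move=> iz zj; have ij : (i <= j)%R by rewrite -zpow_le (le_trans iz).
have [|||p pE] := @tX_convex (sval (z - tV *~ i)%R) `|j - i|%N.
- exact: skel_invertible.
- by rewrite -(skel_val0 ab) -(skel_leD (tV *~ i)%R) add0r subrK.
- rewrite -zpow_nat -(skel_leD (tV *~ i)%R) subrK.
  by rewrite [X in _ <= X]skel_valD -[X in _ <= X]zpowD (_ : _ + i = j)%R //;
    lia.
exists (p%:Z + i)%R; rewrite mulrzDr -[LHS](subrK (tV *~ i)%R); congr (_ + _)%R.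
by apply: skel_inj; rewrite pE -zpow_nat.
Qed.

(** A multiple of [z] that is a power of [t] bounds [z] from both sides, and the
    powers of [t] are convex. *)
Lemma tV_torsion_free (z : V) (m : int) : m != 0 ->
  (exists j, (z *~ m = tV *~ j)%R) -> exists j, (z = tV *~ j)%R.
Proof.
have bound (w : V) p j : (w *+ p.+1 = tV *~ j)%R -> sval w <= zpow `|j|%N.
  move=> wj; have /orP[//|jw] := Gtotal (skel_invertible w) (zpow_invertible
    `|j|%N).
  have w1 : 1 <= sval w by apply: le_trans jw; rewrite -zpow0 zpow_le.
  apply: le_trans (_ : sval (w *+ p.+1)%R <= _); last by rewrite wj zpow_le;
    lia.
  rewrite skel_valMn; elim: p {wj} => // p IHp.
  by rewrite expgS -{1}[sval w]mul1g lemul2.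
move=> m0 [j zj].
wlog : m m0 j zj / (0 < m)%R => [H|].
  have [m1|m1] := ltrP 0%R m; first exact: H zj m1.
  by apply: (H (- m)%R _ (- j)%R); rewrite ?oppr_eq0 ?mulrNz ?zj //; lia.
case: m zj {m0} => [[|p]|] // zj _.
have up := bound _ _ _ zj.
have dn : sval (- z)%R <= zpow `|j|%N.
  have := @bound (- z)%R p (- j)%R; rewrite mulNrn mulrNz abszN; apply.
  by congr (- _)%R.
apply: (zpow_convex (i := (- `|j|%N%:Z)%R)) up.
by rewrite -[z]opprK /zpow mulrNz skel_leN.
Qed.

Definition commutes_a (z : V) := sval z * a = a * sval z.

Lemma commutes_a0 : commutes_a 0%R.
Proof. by rewrite /commutes_a skel_val0 mul1g mulg1. Qed.

Lemma commutes_aB (z w : V) : commutes_a z -> commutes_a w ->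
  commutes_a (z - w)%R.
Proof.
rewrite /commutes_a skel_valD skel_valN => za wa; have wE := skel_invertible w.
have waV : ladj (sval w) * a = a * ladj (sval w).
  rewrite -[a in RHS](invertible_mulKl wE) wa -!mulgA.
  by rewrite invertiblegV // mulg1.
by rewrite -mulgA waV !mulgA za.
Qed.

(** Conjugation by [t ^+ k] shifts the orbit by a full period. *)
Lemma commutes_aZ m : commutes_a (tV *~ (k%:Z * m))%R.
Proof.
rewrite mulrzA.
have [_] := subgroup_closed commutes_a0 commutes_aB; apply.
rewrite /commutes_a -[sval _]/(zpow k%:Z) zpow_nat (tX_orbit k 0) addn0.
by congr (_ * _); apply: (@orbit_eqmod k 0); rewrite modnn mod0n.
Qed.

(** Every invertible element permutes the orbit like a power of [t]. *)
Lemma commutes_a_mod (z : V) : exists j, commutes_a (z - tV *~ j)%R.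
Proof.
have [j zj] := invertible_permutes_orbit (skel_invertible z).
exists (Posz j); rewrite /commutes_a -mulrNz addrC skel_valD mulrNz skel_valN.
rewrite -[sval (_ *~ _)%R]/(zpow j%:Z) zpow_nat.
have tE := invertibleX j t_invertible.
have ta : t ^+ j * a = dadjn j a * t ^+ j by rewrite (tX_orbit j 0) addn0.
have za : sval z * a = dadjn j a * sval z := zj 0%N.
have taV : ladj (t ^+ j) * dadjn j a = a * ladj (t ^+ j).
  by rewrite -[a in RHS](invertible_mulKl tE) ta -!mulgA invertiblegV // mulg1.
by rewrite -mulgA za !mulgA taV.
Qed.

(** ** Finite generation of the group of invertible elements *)

(** The elements that lie between two elements of [G0] in the same coset of the
    powers of [t] form a subalgebra, which contains the generators by
    [near_invertible]; and an invertible element of it belongs to [G0] by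
    convexity. *)
Lemma skel_genmod : finitely_generated L ->
  exists r (g : 'I_r -> V), genmod tV g.
Proof.
case=> X /finite_seqP[s ->] Xgen.
have near i : exists w : V, nth 1 s i <= sval w * t ^+ k.-1 /\
    sval w <= nth 1 s i * t ^+ k.-1.
  by have [_ /(@skel_surj _ _ ab)[w <-] ?] := near_invertible (nth 1 s i);
    exists w.
have [g gP] := choice near.
exists (size s), (fun i => g i).
pose G0 (z : V) := exists (c : 'I_(size s) -> int) j,
  (z = \sum_(i < size s) g i *~ c i + tV *~ j)%R.
have G0t (z : V) j : G0 z -> G0 (z + tV *~ j)%R.
  by case=> c [m ->]; exists c, (m + j)%R; rewrite mulrzDr addrA.
have G00 : G0 0%R.
  by exists (fun=> 0%R), 0%R; rewrite mulr0z addr0 big1.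
have G0B (z w : V) : G0 z -> G0 w -> G0 (z - w)%R.
  case=> c [m ->] [c' [m' ->]]; exists (fun i => c i - c' i)%R, (m - m')%R.
  rewrite mulrzBr opprD addrACA -sumrB; congr (_ + _)%R.
  by apply: eq_bigr => i _; rewrite mulrzBr.
have [G0D _] := subgroup_closed G00 G0B.
pose S x := exists (z : V) j, [/\ G0 z, sval z <= x & x <= sval (z + tV *~
  j)%R].
suff Sall x : S x.
  move=> z; have [w [j [wG wz zw]]] := Sall (sval z).
  have [] := @zpow_convex (z - w)%R 0%R j.
  - by rewrite zpow0 -(skel_val0 ab) -(skel_leD w) add0r subrK.
  - by rewrite /zpow -(skel_leD w) subrK addrC.
  by move=> l zl; rewrite -[z](subrK w) zl addrC; exact: G0t.
have : [set: L]%classic x by [].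
rewrite -Xgen; apply: smallest_sub; last first.
  move=> y /(nthP 1)[i si <-]; have [up dn] := gP i.
  exists (g i - tV *~ k.-1%:Z)%R, (k.-1%:Z + k.-1%:Z)%R; split.
  - rewrite -mulrNz; apply: G0t; exists (fun l => Posz (l == Ordinal si)), 0%R.
    rewrite mulr0z addr0 (bigD1 (Ordinal si)) //= eqxx big1 ?addr0 // => l li.
    by rewrite (negbTE li).
  - rewrite -(invertible_leMr _ _ (zpow_invertible k.-1%:Z)) -skel_valD subrK.
    by rewrite zpow_nat.
  - by rewrite mulrzDr addrA subrK skel_valD -[sval (_ *~ _)%R]/(zpow k.-1%:Z)
    zpow_nat.
have S1 : S 1 by exists 0%R, 0%R; rewrite mulr0z addr0 skel_val0.
have Sadj y (z : V) j : G0 z -> sval z <= y -> y <= sval (z + tV *~ j)%R ->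
    G0 (- (z + tV *~ j))%R /\ (- (z + tV *~ j) + tV *~ j = - z)%R.
  move=> zG _ _; split; first by rewrite -[(- _)%R]sub0r; apply: G0B => //;
    exact: G0t.
  by rewrite opprD subrK.
split=> // [y y'|y y'|y y'|y|y].
- move=> [z [j [zG zy yz]]] [z' [j' [zG' zy' yz']]].
  exists (z + z')%R, (j + j')%R; split; first exact: G0D.
    by rewrite skel_valD lemul2.
  by rewrite mulrzDr addrACA skel_valD lemul2.
- move=> [z [j [zG zy yz]]] [z' [j' [zG' zy' yz']]].
  have /orP[zz|zz] := Gtotal (skel_invertible z) (skel_invertible z').
    exists z, j; rewrite lexI zy (le_trans zz) //; split=> //.
    exact: le_trans (leIl _ _) yz.
  exists z', j'; rewrite lexI zy' (le_trans zz) //; split=> //.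
  exact: le_trans (leIr _ _) yz'.
- move=> [z [j [zG zy yz]]] [z' [j' [zG' zy' yz']]].
  have [q [jq jq']] : exists q : int, (j <= q)%R /\ (j' <= q)%R.
    by exists (`|j| + `|j'|)%R; split; lia.
  have up (w : V) i : (i <= q)%R -> sval (w + tV *~ i)%R <= sval (w + tV *~
    q)%R.
    by move=> iq; rewrite !skel_valD lemul2l // -!/(zpow _) zpow_le.
  have /orP[zz|zz] := Gtotal (skel_invertible z) (skel_invertible z').
    exists z', q; split=> //; first by rewrite (le_trans zy') // leUr.
    rewrite leUx (le_trans yz' (up _ _ jq')) andbT.
    by rewrite (le_trans yz) // (le_trans (up _ _ jq)) // skel_leD.
  exists z, q; split=> //; first by rewrite (le_trans zy) // leUl.
  rewrite leUx (le_trans yz (up _ _ jq)) /=.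
  by rewrite (le_trans yz') // (le_trans (up _ _ jq')) // skel_leD.
- move=> [z [j [zG zy yz]]]; have [zG' zE] := Sadj _ _ _ zG zy yz.
  exists (- (z + tV *~ j))%R, j; split=> //; rewrite ?zE skel_valN;
    exact: le_ladj.
- move=> [z [j [zG zy yz]]]; have [zG' zE] := Sadj _ _ _ zG zy yz.
  exists (- (z + tV *~ j))%R, j; split=> //;
    rewrite ?zE skel_valN skel_invertible;
    exact: le_radj.
Qed.


(** * The representation by periodic maps *)

Section Representation.
Context (H : V -> Prop).
Hypotheses (H0 : H 0%R) (HB : forall z w : V, H z -> H w -> H (z - w)%R).
Hypothesis H_comm : forall z, H z -> commutes_a z.
Hypothesis H_span : forall z : V, exists j, H (z - tV *~ j)%R.
Hypothesis H_triv : forall j, H (tV *~ j)%R -> (tV *~ j = 0)%R.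

Definition H_mem : {pred L} := fun x => `[< exists2 z, H z & sval z = x >].

Lemma H_memP x : reflect (exists2 z, H z & sval z = x) (x \in H_mem).
Proof. exact: asboolP. Qed.

Fact H_mem1 : 1 \in H_mem.
Proof. by apply/H_memP; exists 0%R => //; exact: skel_val0. Qed.

Fact H_memM : {in H_mem &, forall x y, x * y \in H_mem}.
Proof.
have [HD _] := subgroup_closed H0 HB.
move=> _ _ /H_memP[z zH <-] /H_memP[w wH <-]; apply/H_memP.
by exists (z + w)%R; [exact: HD | exact: skel_valD].
Qed.

Fact H_memV : {in H_mem, forall x, ladj x \in H_mem}.
Proof.
move=> _ /H_memP[z zH <-]; apply/H_memP; exists (- z)%R => //.
by rewrite -[(- z)%R]sub0r; exact: HB.
Qed.

Fact H_mem_invertible : {in H_mem, forall x, invertible x}.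
Proof. by move=> _ /H_memP[z zH <-]; exact: skel_invertible. Qed.

Fact H_mem_total : {in H_mem &, forall x y, (x <= y) || (y <= x)}.
Proof. by move=> x y /H_mem_invertible xE /H_mem_invertible yE;
  exact: Gtotal. Qed.

Definition H_sub : total_subgroup L :=
  TotalSubgroup H_mem1 H_memM H_memV H_mem_invertible H_mem_total.

Local Notation HT := (tsub_type H_sub).
Local Notation R := (lexprod HT (FkZ k)).
Implicit Types (u v : HT) (p q : R).

Lemma compl_val u : exists2 z : V, H z & sval z = tsub_val u.
Proof. by apply/H_memP; exact: (valP u). Qed.

Lemma compl_of (z : V) : H z -> exists u, tsub_val u = sval z.
Proof.
move=> zH; have zS : sval z \in tsub_mem H_sub by apply/H_memP; exists z.
by exists (TSub zS).
Qed.

Lemma compl_invertible u : invertible (tsub_val u).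
Proof. by have [z _ <-] := compl_val u; exact: skel_invertible. Qed.

Lemma compl_max_closure_comm u : tsub_val u * A = A * tsub_val u.
Proof.
have [z /H_comm za <-] := compl_val u.
by apply: max_closure_comm => //; exact: skel_invertible.
Qed.

Lemma zpowk_max_closure_comm m : zpow (k%:Z * m)%R * A = A * zpow (k%:Z * m)%R.
Proof.
by apply: max_closure_comm; [exact: zpow_invertible | exact: commutes_aZ].
Qed.

Lemma compl_zpow_invertible u m : invertible (tsub_val u * zpow m).
Proof. by apply: invertibleM (compl_invertible u) (zpow_invertible m). Qed.

(** The complement meets the powers of [t] trivially and these are convex, so
    elements of the complement are compared first. *)
Lemma compl_lt u v m m' : u < v -> tsub_val u * zpow m <= tsub_val v * zpow m'.
Proof.
move=> uv; have /orP[//|le] := Gtotal (compl_zpow_invertible u m)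
  (compl_zpow_invertible v m').
have [z zH zu] := compl_val u; have [w wH wv] := compl_val v.
have zw : sval z <= sval w by rewrite zu wv -tsub_leE ltW.
have [l wl] : exists l, (w - z = tV *~ l)%R.
  apply: (@zpow_convex (w - z)%R 0%R (m - m')%R).
    by rewrite zpow0 -(skel_val0 ab) -(skel_leD z) add0r subrK.
  rewrite /zpow -(skel_leD (z + tV *~ m')%R).
  rewrite addrA subrK addrCA -mulrzDr subrK !skel_valD zu wv.
  exact: le.
have : (w - z)%R = 0%R by rewrite wl; apply: H_triv; rewrite -wl; exact: HB.
move/subr0_eq => wz; move: uv; rewrite (_ : u = v) ?ltxx //.
by apply: val_inj; rewrite /= -zu -wv wz.
Qed.

Lemma compl_zpow_le u v m m' : (tsub_val u * zpow m <= tsub_val v * zpow m') =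
  (u < v) || (u == v) && (m <= m')%R.
Proof.
case: (ltgtP u v) => [uv|vu|->] /=.
- exact: compl_lt.
- apply/negbTE/negP => le; have := compl_lt (m' + 1)%R m vu.
  move/le_trans/(_ le); rewrite invertible_leMl ?zpow_le;
    [lia|exact: compl_invertible].
- by rewrite invertible_leMl ?zpow_le //; exact: compl_invertible.
Qed.

Lemma compl_zpow_inj u v m m' : tsub_val u * zpow m = tsub_val v * zpow m' ->
  u = v /\ m = m'.
Proof.
move=> E; have := compl_zpow_le u v m m'; have := compl_zpow_le v u m' m.
rewrite E lexx; case: (ltgtP u v) => // -> /= h1 h2; split=> //.
by apply: le_anti; rewrite -h1 -h2.
Qed.

Lemma compl_point_le u v m m' :
  (tsub_val u * zpow m * A <= tsub_val v * zpow m' * A) =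
  (u < v) || (u == v) && (m <= m')%R.
Proof. by rewrite -compl_zpow_le; apply: max_closure_leMr;
  exact: compl_zpow_invertible. Qed.

Lemma compl_point_inj u v m m' :
  tsub_val u * zpow m * A = tsub_val v * zpow m' * A ->
  u = v /\ m = m'.
Proof.
by move=> E; apply/compl_zpow_inj/max_closure_injMr => //;
  exact: compl_zpow_invertible.
Qed.

Lemma point_exists x j : exists um : HT * int,
  x * zpow j * A = tsub_val um.1 * zpow um.2 * A.
Proof.
have [_ /(@skel_surj _ _ ab)[w <-] ->] := max_closure_action (x * zpow j).
have [m /compl_of[u uE]] := H_span w; exists (u, m).
by rewrite /= uE -skel_valD subrK.
Qed.

Lemma point_period x i j u m : x * zpow i * A = tsub_val u * zpow m * A ->
  x * zpow (i + k%:Z * j)%R * A = tsub_val u * zpow (m + k%:Z * j)%R * A.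
Proof.
by move=> E; rewrite !zpowD -!mulgA !zpowk_max_closure_comm !mulgA E.
Qed.

(** The component in the complement is monotone in the point and the same after
    each period, hence constant. *)
Lemma point_component x i j u v m m' :
  x * zpow i * A = tsub_val u * zpow m * A ->
  x * zpow j * A = tsub_val v * zpow m' * A -> u = v.
Proof.
have mono i' j' u' v' l l' : x * zpow i' * A = tsub_val u' * zpow l * A ->
    x * zpow j' * A = tsub_val v' * zpow l' * A -> (i' <= j')%R -> u' <= v'.
  move=> E E' ij; have : x * zpow i' * A <= x * zpow j' * A.
    by rewrite lemul2r // lemul2l // zpow_le.
  by rewrite E E' compl_point_le => /orP[/ltW|/andP[/eqP->]].
move=> E E'; apply: le_anti; apply/andP; split.
- apply: (mono i (j + k%:Z * `|i - j|%N%:Z)%R _ _ _ _ E (point_period _ E')).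
  by have := leq_pmull `|i - j|%N k_gt0; lia.
- apply: (mono j (i + k%:Z * `|i - j|%N%:Z)%R _ _ _ _ E' (point_period _ E)).
  by have := leq_pmull `|i - j|%N k_gt0; lia.
Qed.

Definition fun_of p : int -> int := FZ_fun (periodic_val p.2).

Definition represents x p := forall j : int,
  x * zpow j * A = tsub_val p.1 * zpow (fun_of p j) * A.

Lemma fun_of_mono p : {homo fun_of p : i j / (i <= j)%R}.
Proof. exact: FZ_homo. Qed.

Lemma fun_of_period p j : fun_of p (j + k%:Z)%R = (fun_of p j + k%:Z)%R.
Proof. by have /(FkZ_mem _ k_gt0) := valP p.2; apply. Qed.

Lemma R_eq p q : p.1 = q.1 -> (forall j, fun_of p j = fun_of q j) -> p = q.
Proof.
case: p q => [u F] [v G] /= -> FG; congr (_, _).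
by apply/val_inj/val_inj/funext.
Qed.

Lemma represents_exists x : exists p, represents x p.
Proof.
have [um umP] := choice (point_exists x).
pose u := (um 0%R).1; pose phi j := (um j).2.
have uE j : (um j).1 = u by exact: point_component (umP j) (umP 0%R).
have phiP j : x * zpow j * A = tsub_val u * zpow (phi j) * A by rewrite umP uE.
have mono : {homo phi : i j / (i <= j)%R}.
  move=> i j ij; have : x * zpow i * A <= x * zpow j * A.
    by rewrite lemul2r // lemul2l // zpow_le.
  by rewrite !phiP compl_point_le ltxx eqxx.
have per j : phi (j + k%:Z)%R = (phi j + k%:Z)%R.
  have := point_period 1%R (phiP j); rewrite mulr1 phiP.
  by case/compl_point_inj.
pose F := MkFZ (FZ_mem_periodic k_gt0 mono per).
have FP : F \in periodic_mem FZ k by apply/FkZ_mem.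
by exists (u, PeriodicSub FP : FkZ k).
Qed.

Lemma represents_inj x p q : represents x p -> represents x q -> p = q.
Proof.
move=> xp xq; apply: R_eq => [|j].
  by have := xp 0%R; rewrite xq => /compl_point_inj[].
by have := xp j; rewrite xq => /compl_point_inj[].
Qed.

Lemma represents_le x y p q : represents x p -> represents y q ->
  (x <= y) = (p <= q).
Proof.
move=> xp yq; have pq : (p <= q) = (p.1 < q.1) || (p.1 == q.1) && (p.2 <= q.2)
  by [].
have p2 : (p.2 <= q.2) = `[< forall j, (fun_of p j <= fun_of q j)%R >].
  rewrite -Order.le_val; apply/FZ_leP/asboolP; exact.
apply/idP/idP => [xy|].
  have le j : (p.1 < q.1) || (p.1 == q.1) && (fun_of p j <= fun_of q j)%R.
    by rewrite -compl_point_le -xp -yq lemul2r // lemul2r.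
  rewrite pq p2; case: (ltgtP p.1 q.1) (le) => //= [_ /(_ 0%R) //|_ {}le].
  exact/asboolP.
move=> le; apply: max_closure_faithful => m;
  rewrite -zpow_nat xp yq compl_point_le.
move: le; rewrite pq p2 => /orP[->//|/andP[-> /asboolP ->]].
by rewrite orbT.
Qed.

Lemma represents_mul x y p q : represents x p -> represents y q ->
  represents (x * y) (p * q).
Proof.
move=> xp yq j; have := yq j; set m := fun_of q j => yE.
have -> : fun_of (p * q) j = fun_of p m by [].
have -> : tsub_val (p * q).1 = tsub_val p.1 * tsub_val q.1 by [].
rewrite -!mulgA [y * _]mulgA yE.
rewrite (Gcomm (compl_invertible q.1) (zpow_invertible m)) -!mulgA
  compl_max_closure_comm.
rewrite [zpow m * _]mulgA [x * _]mulgA [x * _]mulgA xp -!mulgA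
  -compl_max_closure_comm !mulgA.
congr (_ * _); rewrite -!mulgA; congr (_ * _).
exact: Gcomm (zpow_invertible _) (compl_invertible _).
Qed.

(** The map [phi] is the meet over one period of the maps given by
    [c j := t^(phi j) * A * t^(-j)]: each of them agrees with [phi] at the points
    congruent to [j] and is at least [phi] elsewhere, since its value at [i] is that
    of [phi] at the first point congruent to [j] that is not below [i]. *)
Lemma represents_surj p : exists x, represents x p.
Proof.
pose phi := fun_of p.
pose c (j : int) := zpow (phi j) * A * zpow (- j)%R.
have c_ge j i : zpow (phi i) * A <= c j * zpow i * A.
  (* [j + k * (q + 1)] is the first point congruent to [j] from [i] on. *)
  pose q := divz (i - j - 1)%R k.
  have [e1 e2] : (0 <= (i - j - 1) - q * k%:Z)%R /\ ((i - j - 1) - q * k%:Z <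
    k%:Z)%R.
    have [k1 k2] : (k%:Z != 0)%R /\ (0 < k%:Z)%R by split; lia.
    have := divz_eq (i - j - 1)%R k; have := modz_ge0 (i - j - 1)%R k1.
    have := ltz_pmod (i - j - 1)%R k2; rewrite -/q; lia.
  have iE : (- j + i = k%:Z * q + 1 + (i - j - 1 - q * k%:Z))%R by lia.
  rewrite /c -!mulgA [zpow (- j)%R * _]mulgA -zpowD.
  apply: le_trans (_ : zpow (phi j) * (A * (zpow (k%:Z * q + 1)%R * A)) <= _);
    last first.
    by rewrite !lemul2l // lemul2r // zpow_le iE; lia.
  rewrite zpowD -!mulgA [A * (zpow _ * _)]mulgA -zpowk_max_closure_comm -!mulgA.
  rewrite [A * (zpow 1 * A)]mulgA (zpow_nat 1) expg1 max_closure_t -zpow_nat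
    !mulgA -!zpowD.
  rewrite lemul2r // zpow_le -addrA -[X in (X <= _)%R]/(fun_of p i).
  have -> : (k%:Z * q + k%:Z = k%:Z * (q + 1))%R by lia.
  rewrite -(FkZ_addM _ _ (fun_of_period p)); apply: fun_of_mono; lia.
have c_le j (l : int) : c j * zpow (j + k%:Z * l)%R * A <=
    zpow (phi (j + k%:Z * l)%R) * A.
  have -> : c j * zpow (j + k%:Z * l)%R * A = zpow (phi j) * (A * A) * zpow
    (k%:Z * l)%R.
    by rewrite /c -!mulgA [zpow (- j)%R * _]mulgA -zpowD addKr
      zpowk_max_closure_comm.
  have -> : zpow (phi (j + k%:Z * l)%R) * A = zpow (phi j) * A * zpow (k%:Z *
    l)%R.
    by rewrite /phi (FkZ_addM _ _ (fun_of_period p)) zpowD -!mulgA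
      zpowk_max_closure_comm.
  by rewrite lemul2r // lemul2l // max_closure_mul_le.
have [y [y_le y_ge]] : exists y, (forall j : nat, (j < k)%N -> y <= c j) /\
    forall i x, (forall j : nat, x <= c j * zpow i * A) -> x <= y * zpow i * A.
  suff [y] : exists y, (forall j : nat, (j < k.-1.+1)%N -> y <= c j) /\
    forall i x, (forall j : nat, x <= c j * zpow i * A) -> x <= y * zpow i * A.
    by rewrite prednK //; exists y.
  elim: k.-1 => [|m [y [y_le y_ge]]].
    by exists (c 0%R); split=> [[|//] _|i x]; [exact: lexx | exact].
  exists (y `&` c m.+1); split=> [j|i x xc].
    rewrite ltnS leq_eqVlt => /predU1P[->|/y_le]; first exact: leIr.
    exact/le_trans/leIl.
  by rewrite !mulgIl lexI xc y_ge.
exists (tsub_val p.1 * y) => i; rewrite -!mulgA; congr (_ * _); rewrite !mulgA.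
apply: le_anti; apply/andP; split; last by apply: y_ge => j; exact: c_ge.
have k_ne0 : (k%:Z != 0)%R by lia.
have [j jk iE] : exists2 j, (j < k)%N & i = (j%:Z + k%:Z * divz i k)%R.
  have := modz_ge0 i k_ne0; have := ltz_mod i k_ne0; have := divz_eq i k.
  by exists `|modz i k|%N; lia.
rewrite iE; apply: le_trans (c_le j _); rewrite lemul2r // lemul2r //.
exact: y_le.
Qed.

Theorem isomorphic_lexprod : lp_isomorphic L R.
Proof.
have [f fP] := choice represents_exists.
have [g gP] := choice represents_surj.
exists f; apply: lp_isomorphism_le.
- exists g => [x|p]; last exact: represents_inj (fP (g p)) (gP p).
  have := gP (f x); have := fP x => h1 h2.
  by apply: le_anti; rewrite (represents_le h1 h2) (represents_le h2 h1) lexx.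
- by move=> x y; exact: represents_inj (fP (x * y)) (represents_mul (fP x) (fP
  y)).
- by move=> x y; rewrite (represents_le (fP x) (fP y)).
Qed.

Lemma compl_comm : commutative (@mul HT).
Proof.
move=> u v; apply: val_inj; rewrite !valM.
exact: Gcomm (compl_invertible u) (compl_invertible v).
Qed.

End Representation.
End Orbital.

(** * The structure theorem *)

Section Proper.
Local Open Scope group_scope.
Local Open Scope order_scope.
Context (n : nat) (n_gt0 : (0 < n)%N) d (L : lpregroupType d).
Hypothesis Lper : forall x : L, dadjn n x = x.

(** If [x * ladj x = 1] for all [x], then also [radj x * x = 1], and both adjoints
    are inverses of [x]. *)
Lemma proper_closure : proper_lpregroup L ->
  exists2 b : L, 1 < b & b * b <= b.
Proof.
move=> Lproper; apply: contrapT => no_closure; apply: Lproper => x.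
have xV (y : L) : y * ladj y = 1.
  apply: contrapT => /eqP y1; apply: no_closure; exists (y * ladj y).
    by rewrite lt_neqAle eq_sym y1 mul_ladj_ge1.
  rewrite -mulgA lemul2l // mulgA -[leRHS]mul1g lemul2r //; exact: ladj_mul_le1.
have := xV (radj x); rewrite radjK => rx.
by rewrite -[ladj x]mul1g -rx -mulgA xV mulg1.
Qed.

(** An orbital element of period 1 would be an invertible element below the
    closure it comes from. *)
Lemma exists_maximal_orbital : proper_lpregroup L -> exists k (a : L),
  [/\ (1 < k)%N, orbital k a & forall k' (z : L), orbital k' z -> (k' <= k)%N].
Proof.
move=> /proper_closure[b b1 bb].
have [z [k0 [zb zorb]]] := exists_orbital n_gt0 Lper b1.
have [z1 k0_gt0 zk0 _] := zorb.
have k0_gt1 : (1 < k0)%N.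
  rewrite ltn_neqAle k0_gt0 andbT eq_sym; apply/eqP => k01.
  have zE : invertible z by apply: invertible_dadj; rewrite k01 in zk0.
  by have := closure_invertible_le1 n_gt0 Lper bb zE zb; rewrite lt_geF.
pose P k := `[< exists a : L, orbital k a >].
have exP : exists k, P k by exists k0; apply/asboolP; exists z.
have P_le k : P k -> (k <= n)%N.
  by move=> /asboolP[a /(orbital_dvd Lper) /dvdn_leq]; exact.
case: (ex_maxnP exP P_le) => k /asboolP[a aorb] kmax; exists k, a; split=> //.
  by apply: leq_trans k0_gt1 _; apply: kmax; apply/asboolP; exists z.
by move=> k' w worb; apply: kmax; apply/asboolP; exists w.
Qed.

End Proper.

Theorem theorem6p8 (n : nat) (hn : 0 < n)
    (d : Order.disp_t) (L : lpregroupType d)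
    (Lfg : finitely_generated L) (Lproper : proper_lpregroup L) (Lper : periodic_lpregroup L n)
    (Lg_total : total (<=%O : rel (group_skeleton L)))
    (Lg_abelian : commutative (@mul (group_skeleton L))) :
  exists (d' : Order.disp_t) (H : totalLGroupType d') (k : nat),
    commutative (@mul H) /\ k %| n /\ lp_isomorphic L (lexprod H (FkZ k)).
Proof.
have dadj_n (x : L) : dadjn n x = x by exact/iter_adjP/Lper.
have Gtotal (g h : L) : invertible g -> invertible h ->
  ((g <= h) || (h <= g))%O.
  move=> gE hE; have := Lg_total (skel_of Lg_abelian gE) (skel_of Lg_abelian
    hE).
  by rewrite -!Order.le_val.
have [k [a [k_gt1 aorb kmax]]] := exists_maximal_orbital hn dadj_n Lproper.
have [r [g gen]] := skel_genmod hn dadj_n k_gt1 aorb Gtotal Lg_abelian kmax Lfg.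
have tors := @tV_torsion_free _ hn _ _ dadj_n _ _ k_gt1 aorb Gtotal Lg_abelian.
have [||| H [H0 HB H_comm H_span H_triv]] :=
  exists_complement (C := @commutes_a _ _ a Lg_abelian) tors gen.
- exact: commutes_a0.
- exact: commutes_aB.
- by move=> z; exact: (commutes_a_mod hn dadj_n k_gt1 aorb Gtotal z).
exists d, (tsub_type (H_sub Gtotal H0 HB)), k; split; last split.
- exact: compl_comm.
- exact: (orbital_dvd dadj_n aorb).
- exact: (isomorphic_lexprod k_gt1 aorb Gtotal kmax H0 HB H_comm H_span H_triv).
Qed.
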